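(* Let $K$, $v$, $\mathcal O_v$, $\mathbf m_v$, $\mathcal I=\langle\mathcal G\rangle$, $A$, $\Lambda$ and the filtration $F^vA$ be as below. Then: (v) $\mathcal G$ is a Gröbner basis of the ideal $\mathcal I\cap\mathcal O_v\langle X\rangle$ of $\mathcal O_v\langle X\rangle$ w.r.t. the same ordering; hence $\mathcal I\cap\mathcal O_v\langle X\rangle=\langle\mathcal G\rangle$ in $\mathcal O_v\langle X\rangle$, i.e. $\Lambda$ defines a good reduction for $A$; (vi) if $\mathcal G\not\subset\mathbf m_v\mathcal O_v\langle X\rangle$, then $\Lambda/\mathbf m_v\Lambda\cong k\langle X\rangle/\langle\overline{\mathcal G}\rangle$ as $k$-algebras, where $k=\mathcal O_v/\mathbf m_v$ and $\overline{\mathcal G}$ is the image of $\mathcal G$ in $\mathcal O_v\langle X\rangle/\mathbf m_v\mathcal O_v\langle X\rangle\cong k\langle X\rangle$; (vii) if $\mathcal G\not\subset\mathbf m_v\mathcal O_v\langle X\rangle$ and $k\langle X\rangle/\langle\overline{\mathcal G}\rangle$ is a domain, then the associated graded ring $G(A)$ of $F^vA$ is a domain, hence $A$ is a domain, and the map $A\to\Gamma\cup\{\infty\}$ sending $0\mapsto\infty$ and $a\mapsto-\gamma$ for $a\in F^v_\gamma A\setminus F^v_{<\gamma}A$ is a valuation on $A$ extending $v$; consequently, if the (skew-)field of fractions $\Delta$ of $A$ exists, $v$ extends to a valuation on $\Delta$. Setup: $K$ a field, $v:K\to\Gamma\cup\{\infty\}$ a valuation, $\mathcal I\subseteq K\langle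 X_1,\dots,X_n\rangle$ generated by a monic Gröbner basis $\mathcal G\subset\mathcal O_v\langle X\rangle$ w.r.t. a monomial ordering, with $\mathrm{LM}(g)\neq1$ for $g\in\mathcal G$; $A=K\langle X\rangle/\mathcal I$, $\Lambda=(\mathcal O_v\langle X\rangle+\mathcal I)/\mathcal I$, and $F^v_\gamma A=\{\sum_i\lambda_i\bar w_i\mid\lambda_i\in F^v_\gamma K,\ \bar w_i\in\overline{N(\mathcal G)}\}$.
   Context: $\Gamma$ is a totally ordered abelian group. A valuation of a ring $S$ is a surjective map $v:S\to\Gamma\cup\{\infty\}$ with $v(a)=\infty\iff a=0$, $v(ab)=v(a)+v(b)$, $v(a+b)\ge\min(v(a),v(b))$. $\mathcal O_v=\{v\ge0\}$, $\mathbf m_v=\{v>0\}$, $F^v_\gamma K=\{\lambda\mid v(\lambda)\ge-\gamma\}$. For a filtration, $F_{<\gamma}S=\bigcup_{\gamma'<\gamma}F_{\gamma'}S$ and $G(S)=\bigoplus_\gamma F_\gamma S/F_{<\gamma}S$. A monomial ordering is a well-ordering on words with $u\prec v\Rightarrow wus\prec wvs$ and $u,v\preceq uv$; $\mathrm{LM},\mathrm{LC}$ are leading word and coefficient; monic means all $\mathrm{LC}=1$; a monic Gröbner basis of an ideal $I$ is a monic $\mathcal G\subset I$ such that every nonzero $f\in I$ has $\mathrm{LM}(f)=w\,\mathrm{LM}(g)\,s$ for some $g\in\mathcal G$ and words $w,s$. $N(\mathcal G)$ is the set of words not containing any $\mathrm{LM}(g)$ as a subword; $\overline{N(\mathcal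 G)}$ its image in $A$. Good reduction: $\Lambda$ defines a good reduction for $A$ if $\mathcal I\cap\mathcal O_v\langle X\rangle=\langle\mathcal G\rangle$ as an ideal of $\mathcal O_v\langle X\rangle$. *)

(* Defs.v *)
(* Noncommutative polynomials K<X_1..X_n> are represented as
   coefficient functions  word n -> K  (words = seq 'I_n) with finite support;
   quotient rings are handled through representatives and the ideal. *)
From HB Require Import structures.
From mathcomp Require Import all_boot all_order all_algebra.
From Stdlib Require List.
Set Implicit Arguments. Unset Strict Implicit. Unset Printing Implicit Defensive.
Import Order.TTheory GRing.Theory.
Local Open Scope ring_scope.

Section OrderedGroup.
Variables (G : zmodType) (leG : rel G).

Definition tot_ord_abgroup : Prop :=
  [/\ reflexive leG, antisymmetric leG, transitive leG, total leG &
      forall x y z, leG x y -> leG (x + z) (y + z)].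

(* None stands for oo *)
Definition ole (a b : option G) : bool :=
  match a, b with
  | _, None => true
  | None, Some _ => false
  | Some x, Some y => leG x y
  end.
Definition olt (a b : option G) : bool := ole a b && (a != b).
Definition oadd (a b : option G) : option G :=
  match a, b with Some x, Some y => Some (x + y) | _, _ => None end.
Definition omin (a b : option G) : option G := if ole a b then a else b.

Definition valuation (S : nzRingType) (v : S -> option G) : Prop :=
  [/\ (forall o, exists a, v a = o),
      (forall a, v a = None <-> a = 0),
      (forall a b, v (a * b) = oadd (v a) (v b)) &
      (forall a b, ole (omin (v a) (v b)) (v (a + b)))].
End OrderedGroup.

Definition word (n : nat) := seq 'I_n.
Definition nc (R : Type) (n : nat) := word n -> R.

Section NC.
Variables (R : nzRingType) (n : nat).

Definition nc0 : nc R n := fun _ => 0.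
Definition ncadd (f g : nc R n) : nc R n := fun w => f w + g w.
Definition ncopp (f : nc R n) : nc R n := fun w => - f w.
Definition ncsub (f g : nc R n) : nc R n := ncadd f (ncopp g).
Definition ncmul (f g : nc R n) : nc R n :=
  fun w => \sum_(i < (size w).+1) f (take i w) * g (drop i w).
Definition ncconst (c : R) : nc R n := fun w => if w == [::] then c else 0.
Definition nc1 : nc R n := ncconst 1.
Definition ncscale (c : R) (f : nc R n) : nc R n := fun w => c * f w.
Definition ncsum (I : Type) (s : seq I) (F : I -> nc R n) : nc R n :=
  \big[ncadd/nc0]_(i <- s) F i.

Definition ncpoly (f : nc R n) : Prop :=
  exists s : seq (word n), forall w, f w != 0 -> w \in s.
Definition ncnonzero (f : nc R n) : Prop := exists w, f w != 0.

Definition gen_ideal (P S : nc R n -> Prop) (f : nc R n) : Prop :=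
  exists l : seq (nc R n * nc R n * nc R n),
    List.Forall (fun t => [/\ P t.1.1, S t.1.2 & P t.2]) l /\
    forall w, f w = ncsum l (fun t => ncmul (ncmul t.1.1 t.1.2) t.2) w.

Definition quot_domain (P J : nc R n -> Prop) : Prop :=
  ~ J nc1 /\ forall a b, P a -> P b -> J (ncmul a b) -> J a \/ J b.

Variable prec : rel (word n).

Definition is_LM (f : nc R n) (w : word n) : Prop :=
  f w != 0 /\ forall u, f u != 0 -> u = w \/ prec u w.
Definition monic_set (S : nc R n -> Prop) : Prop :=
  forall g, S g -> exists w, is_LM g w /\ g w = 1.
Definition groebner (I S : nc R n -> Prop) : Prop :=
  (forall g, S g -> I g) /\ monic_set S /\
  forall f, I f -> ncnonzero f ->
    exists wf g wg l r, [/\ is_LM f wf, S g, is_LM g wg & wf = l ++ wg ++ r].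
Definition normal_word (S : nc R n -> Prop) (w : word n) : Prop :=
  forall g wg, S g -> is_LM g wg -> ~~ infix wg w.
End NC.

Definition monomial_ordering (n : nat) (prec : rel (word n)) : Prop :=
  irreflexive prec /\ transitive prec /\
  (forall u v, u != v -> prec u v || prec v u) /\
  well_founded (fun u v => prec u v) /\
  (forall u v w s, prec u v -> prec (w ++ u ++ s) (w ++ v ++ s)) /\
  (forall u v, ((u == u ++ v) || prec u (u ++ v)) &&
               ((v == u ++ v) || prec v (u ++ v))).

Section Valued.
Variables (K : fieldType) (G : zmodType) (leG : rel G) (v : K -> option G).
Variable (n : nat).

Definition Ov (x : K) : bool := ole leG (Some 0) (v x).
Definition mv (x : K) : bool := olt leG (Some 0) (v x).
Definition FvK (g : G) (x : K) : bool := ole leG (Some (- g)) (v x).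

Definition Ovpoly (f : nc K n) : Prop := ncpoly f /\ forall w, Ov (f w).
Definition mvOvpoly (f : nc K n) : Prop := ncpoly f /\ forall w, mv (f w).

Variables (prec : rel (word n)) (Gb : nc K n -> Prop).

Definition Iof : nc K n -> Prop := gen_ideal (@ncpoly K n) Gb.

Definition good_reduction : Prop :=
  forall f, (Iof f /\ Ovpoly f) <-> gen_ideal Ovpoly Gb f.

(* representatives of Lambda = (O_v<X> + I)/I, and of m_v Lambda *)
Definition Lam (f : nc K n) : Prop :=
  ncpoly f /\ exists h, Ovpoly h /\ Iof (ncsub f h).
Definition mLam (f : nc K n) : Prop :=
  ncpoly f /\ exists h, mvOvpoly h /\ Iof (ncsub f h).

Definition filtA (g : G) (a : nc K n) : Prop :=
  ncpoly a /\ exists p, [/\ ncpoly p,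
     (forall w, p w != 0 -> normal_word prec Gb w /\ FvK g (p w)) &
     Iof (ncsub a p)].
Definition filtA_lt (g : G) (a : nc K n) : Prop :=
  exists g', (leG g' g && (g' != g)) /\ filtA g' a.

(* associated graded ring G(A): an element is a family x (x g in F_g A),
   with finite support list sx (outside sx, x g is in F_<g A) *)
Definition gr_elt (x : G -> nc K n) (sx : seq G) : Prop :=
  uniq sx /\ (forall g, filtA g (x g)) /\ (forall g, g \notin sx -> filtA_lt g (x g)).
Definition gr_zero (x : G -> nc K n) : Prop := forall g, filtA_lt g (x g).
Definition gr_mul (x : G -> nc K n) (sx : seq G) (y : G -> nc K n) (sy : seq G)
  : G -> nc K n :=
  fun g => ncsum sx (fun a => ncsum [seq b <- sy | a + b == g]
                                   (fun b => ncmul (x a) (y b))).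
Definition graded_domain : Prop :=
  ~ filtA_lt 0 (@nc1 K n) /\
  forall x sx y sy, gr_elt x sx -> gr_elt y sy -> ~ gr_zero x -> ~ gr_zero y ->
    ~ gr_zero (gr_mul x sx y sy).

Definition quot_valuation (nu : nc K n -> option G) : Prop :=
  (forall a b, ncpoly a -> ncpoly b -> Iof (ncsub a b) -> nu a = nu b) /\
  (forall o, exists a, ncpoly a /\ nu a = o) /\
  (forall a, ncpoly a -> (nu a = None <-> Iof a)) /\
  (forall a b, ncpoly a -> ncpoly b -> nu (ncmul a b) = oadd (nu a) (nu b)) /\
  (forall a b, ncpoly a -> ncpoly b -> ole leG (omin leG (nu a) (nu b)) (nu (ncadd a b))).

Definition is_filt_val (nu : nc K n -> option G) : Prop :=
  (forall a, ncpoly a -> Iof a -> nu a = None) /\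
  (forall a g, ncpoly a -> ~ Iof a -> filtA g a -> ~ filtA_lt g a -> nu a = Some (- g)).

Definition frac_field (D : unitRingType) (iota : nc K n -> D) : Prop :=
  (forall x : D, x != 0 -> x \is a GRing.unit) /\
  (forall a b, ncpoly a -> ncpoly b ->
     iota (ncadd a b) = iota a + iota b /\ iota (ncmul a b) = iota a * iota b) /\
  iota (@nc1 K n) = 1 /\
  (forall a b, ncpoly a -> ncpoly b -> (iota a = iota b <-> Iof (ncsub a b))) /\
  (forall d, exists a s, [/\ ncpoly a, ncpoly s, ~ Iof s & d = iota a * (iota s)^-1]).

Section Residue.
Variables (k : fieldType) (pi : K -> k).

Definition residue_map : Prop :=
  (forall a b, Ov a -> Ov b -> pi (a + b) = pi a + pi b /\ pi (a * b) = pi a * pi b) /\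
  pi 1 = 1 /\
  (forall c, exists a, Ov a /\ pi a = c) /\
  (forall a, Ov a -> (pi a = 0 <-> mv a)).

Definition Gbar (h : nc k n) : Prop := exists g, Gb g /\ forall w, h w = pi (g w).
Definition Jbar : nc k n -> Prop := gen_ideal (@ncpoly k n) Gbar.

(* Lambda / m_v Lambda ~= k<X>/<Gbar> as k-algebras (via representatives) *)
Definition lam_iso : Prop :=
  exists phi : nc K n -> nc k n,
    [/\ (forall f, Lam f -> ncpoly (phi f)),
        (forall f f', Lam f -> Lam f' -> (mLam (ncsub f f') <-> Jbar (ncsub (phi f) (phi f')))),
        (forall h, ncpoly h -> exists f, Lam f /\ Jbar (ncsub h (phi f))),
        (forall f f', Lam f -> Lam f' ->
           Jbar (ncsub (phi (ncadd f f')) (ncadd (phi f) (phi f'))) /\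
           Jbar (ncsub (phi (ncmul f f')) (ncmul (phi f) (phi f')))) &
        Jbar (ncsub (phi (@nc1 K n)) (@nc1 k n)) /\
        (forall c f, Ov c -> Lam f ->
           Jbar (ncsub (phi (ncscale c f)) (ncscale (pi c) (phi f))))].
End Residue.
End Valued.

(* Main.v *)
Require Import Defs.
From mathcomp Require Import all_boot all_order all_algebra.
From mathcomp Require Import ring.
From Stdlib Require Import FunctionalExtensionality ClassicalEpsilon.
Set Implicit Arguments. Unset Strict Implicit. Unset Printing Implicit Defensive.
Import GRing.Theory.
Local Open Scope ring_scope.

(* Rewriting a word by the monic elements of Gb involves only coefficients in O_v, so every
   polynomial has a unique normal form modulo the ideal, and the normal form stays in any
   O_v-submodule of K (O_v, m_v or F_gamma) that contains the coefficients. An element of the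
   ideal has normal form 0, which gives the good reduction, and reducing the coefficients modulo
   m_v identifies Lambda / m_v Lambda with k<X>/<Gbar>. The level of an element in the filtration
   is minus the least value of the coefficients of its normal form. After scaling two elements to
   level 0, their product has level 0 because k<X>/<Gbar> is a domain; hence levels add up. On
   fractions one puts w(a/s) = nu(a) - nu(s). *)

(** * Noncommutative polynomials *)

(** Confluence of rewriting is never studied. Existence of normal forms is a well-founded induction
    on words; uniqueness is the Gröbner property, which leaves 0 as the only element of the ideal
    supported on normal words. Over [O_v] it matters where the error of a reduction lies, not only
    where the coefficients do: it is kept in the ideal generated with multipliers in [O_v], which a
    priori is smaller than the intersection of [I] with [O_v<X>]. Two obstacles shape the rest. If
    the value group is trivial, every [F_<gamma] is empty, so lying outside it does not even exclude
    elements of the ideal. And [A] is not commutative: its fractions are given only in the form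
    [a s^-1], so common denominators have to be extracted from that description. *)

Section NCRing.
Variables (R : nzRingType) (n : nat).
Implicit Types (f g h : nc R n) (w u l r : word n) (c : R).

Lemma ncext f g : f =1 g -> f = g.
Proof. by move=> fg; apply: functional_extensionality. Qed.

Definition ncmon c u : nc R n := fun w => if w == u then c else 0.
(** The left quotient by the letter [x], known for formal power series as the Brzozowski derivative;
    [ncshift_mul] is its product rule. *)
Definition ncshift (x : 'I_n) f : nc R n := fun w => f (x :: w).

Lemma ncmul_nil f g : ncmul f g [::] = f [::] * g [::].
Proof. by rewrite /ncmul big_ord1. Qed.

(** Separating the cut before the first letter makes the convolution a recursion on words, so
    associativity needs no reindexing of a double sum. *)
Lemma ncmul_cons f g x w :
  ncmul f g (x :: w) = f [::] * g (x :: w) + ncmul (ncshift x f) g w.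
Proof. by rewrite /ncmul big_ord_recl. Qed.

Lemma ncmulDl f g h : ncmul (ncadd f g) h = ncadd (ncmul f h) (ncmul g h).
Proof.
by apply: ncext => w; rewrite /ncmul /ncadd -big_split; apply: eq_bigr => i _; rewrite mulrDl.
Qed.

Lemma ncmulDr f g h : ncmul f (ncadd g h) = ncadd (ncmul f g) (ncmul f h).
Proof.
by apply: ncext => w; rewrite /ncmul /ncadd -big_split; apply: eq_bigr => i _; rewrite mulrDr.
Qed.

Lemma ncscaleAl c f g : ncmul (ncscale c f) g = ncscale c (ncmul f g).
Proof.
by apply: ncext => w; rewrite /ncmul /ncscale mulr_sumr; apply: eq_bigr => i _; rewrite mulrA.
Qed.

Lemma ncmulNl f g : ncmul (ncopp f) g = ncopp (ncmul f g).
Proof.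
by apply: ncext => w; rewrite /ncmul /ncopp -sumrN; apply: eq_bigr => i _; rewrite mulNr.
Qed.

Lemma ncmulNr f g : ncmul f (ncopp g) = ncopp (ncmul f g).
Proof.
by apply: ncext => w; rewrite /ncmul /ncopp -sumrN; apply: eq_bigr => i _; rewrite mulrN.
Qed.

Lemma ncmulBl f g h : ncmul (ncsub f g) h = ncsub (ncmul f h) (ncmul g h).
Proof. by rewrite /ncsub ncmulDl ncmulNl. Qed.

Lemma ncmulBr f g h : ncmul f (ncsub g h) = ncsub (ncmul f g) (ncmul f h).
Proof. by rewrite /ncsub ncmulDr ncmulNr. Qed.

Lemma ncmul0l f : ncmul (@nc0 R n) f = @nc0 R n.
Proof. by apply: ncext => w; rewrite /ncmul big1 // => i _; rewrite mul0r. Qed.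

Lemma ncmul0r f : ncmul f (@nc0 R n) = @nc0 R n.
Proof. by apply: ncext => w; rewrite /ncmul big1 // => i _; rewrite mulr0. Qed.

Lemma ncshift_mul x f g :
  ncshift x (ncmul f g) =
  ncadd (ncscale (f [::]) (ncshift x g)) (ncmul (ncshift x f) g).
Proof. by apply: ncext => w; rewrite /ncshift ncmul_cons. Qed.

Lemma ncmulA f g h : ncmul f (ncmul g h) = ncmul (ncmul f g) h.
Proof.
apply: ncext => w; elim: w f g h => [|x w IH] f g h; first by rewrite !ncmul_nil mulrA.
rewrite !ncmul_cons ncmul_nil IH ncshift_mul ncmulDl ncscaleAl.
by rewrite mulrDr mulrA /ncadd /ncscale addrA.
Qed.

Lemma ncmul_constl c f : ncmul (@ncconst R n c) f = ncscale c f.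
Proof.
apply: ncext => -[|x w]; first by rewrite ncmul_nil.
rewrite ncmul_cons /ncconst eqxx; have -> : ncshift x (@ncconst R n c) = @nc0 R n by apply: ncext.
by rewrite ncmul0l addr0.
Qed.

Lemma ncmul1l f : ncmul (@nc1 R n) f = f.
Proof. by rewrite /nc1 ncmul_constl; apply: ncext => w; rewrite /ncscale mul1r. Qed.

Lemma ncmul_mon_cat c l f w : ncmul (ncmon c l) f (l ++ w) = c * f w.
Proof.
elim: l => [|x l IH] /=.
  have -> : ncmon c [::] = @ncconst R n c by [].
  by rewrite ncmul_constl.
rewrite ncmul_cons /ncmon /= mul0r add0r -IH; congr (ncmul _ f _).
by apply: ncext => u; rewrite /ncshift eqseq_cons eqxx.
Qed.

Lemma ncmul_cat_mon f r w : ncmul f (ncmon 1 r) (w ++ r) = f w.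
Proof.
elim: w f => [|x w IH] f /=.
  case: r => [|y r]; first by rewrite ncmul_nil mulr1.
  (* Every later cut leaves a right factor shorter than the monomial, so only the first term
     survives. *)
  rewrite ncmul_cons /ncmon eqxx mulr1 /ncmul big1 ?addr0 // => i _.
  rewrite ifF ?mulr0 //; apply/negbTE/eqP => /(congr1 size) /=.
  by rewrite size_drop => E; have := leq_subr i (size r); rewrite E ltnn.
rewrite ncmul_cons IH /ncmon ifF ?mulr0 ?add0r //.
apply/negbTE/eqP => /(congr1 size) /=; rewrite size_cat -addSn => /eqP.
by rewrite -{2}(add0n (size r)) eqn_add2r.
Qed.

Lemma ncmul_neq0 f g w : ncmul f g w != 0 ->
  exists u u', [/\ w = u ++ u', f u != 0 & g u' != 0].
Proof.
move=> fg; case: (boolP [exists i : 'I_(size w).+1, f (take i w) * g (drop i w) != 0]).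
  case/existsP=> i fgi; exists (take i w), (drop i w); rewrite cat_take_drop; split=> //.
    by apply: contraNneq fgi => ->; rewrite mul0r.
  by apply: contraNneq fgi => ->; rewrite mulr0.
rewrite negb_exists => /forallP H; case/negP: fg; apply/eqP; apply: big1 => i _.
by apply/eqP/negPn/H.
Qed.

Lemma ncmon_neq0 c u w : ncmon c u w != 0 -> w = u.
Proof. by rewrite /ncmon; case: (eqVneq w u) => // _; rewrite eqxx. Qed.

(** The polynomial [c l g r] subtracted in one rewriting step. The scalar is absorbed in the left
    monomial, so the product has the shape [a g b] of a generator in [gen_ideal]. *)
Definition ncbimon c l g r := ncmul (ncmul (ncmon c l) g) (ncmon 1 r).

Lemma ncbimon_cat c l g r w : ncbimon c l g r (l ++ w ++ r) = c * g w.
Proof. by rewrite /ncbimon catA ncmul_cat_mon ncmul_mon_cat. Qed.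

Lemma ncbimon_neq0 c l g r u : ncbimon c l g r u != 0 ->
  exists2 w, u = l ++ w ++ r & g w != 0.
Proof.
case/ncmul_neq0=> [u1 [u2 [-> /ncmul_neq0 [u3 [u4 [-> /ncmon_neq0 -> gu4]]] /ncmon_neq0 ->]]].
by exists u4 => //; rewrite catA.
Qed.

Lemma ncsum_nil (I : Type) (F : I -> nc R n) : ncsum [::] F = @nc0 R n.
Proof. by rewrite /ncsum big_nil. Qed.

Lemma ncsum_cons (I : Type) i (s : seq I) (F : I -> nc R n) :
  ncsum (i :: s) F = ncadd (F i) (ncsum s F).
Proof. by rewrite /ncsum big_cons. Qed.

Lemma ncsumE (I : Type) (s : seq I) (F : I -> nc R n) w :
  ncsum s F w = \sum_(i <- s) F i w.
Proof. by elim: s => [|i s IH]; rewrite ?ncsum_nil ?ncsum_cons ?big_nil // big_cons -IH. Qed.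

Lemma ncsum_rem (I : eqType) (i : I) (s : seq I) (F : I -> nc R n) :
  i \in s -> ncsum s F = ncadd (F i) (ncsum (rem i s) F).
Proof. by move=> si; apply: ncext => w; rewrite /ncadd !ncsumE (big_rem i). Qed.

Lemma ncsum_closed (I : eqType) (J : nc R n -> Prop) (s : seq I) (F : I -> nc R n) :
  J (@nc0 R n) -> (forall f g, J f -> J g -> J (ncadd f g)) ->
  (forall i, i \in s -> J (F i)) -> J (ncsum s F).
Proof.
move=> J0 JD; elim: s => [|i s IH] JF; first by rewrite ncsum_nil.
rewrite ncsum_cons; apply: JD; first by apply: JF; rewrite mem_head.
by apply: IH => j sj; apply: JF; rewrite inE sj orbT.
Qed.

Lemma ncpoly0 : ncpoly (@nc0 R n).
Proof. by exists [::] => w; rewrite eqxx. Qed.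

Lemma ncpoly_add f g : ncpoly f -> ncpoly g -> ncpoly (ncadd f g).
Proof.
move=> [s fs] [t gt]; exists (s ++ t) => w; rewrite mem_cat.
case: (eqVneq (f w) 0) => [fw|/fs -> //]; case: (eqVneq (g w) 0) => [gw|/gt ->].
  by rewrite /ncadd fw gw addr0 eqxx.
by rewrite orbT.
Qed.

Lemma ncpoly_mul f g : ncpoly f -> ncpoly g -> ncpoly (ncmul f g).
Proof.
move=> [s fs] [t gt]; exists [seq u ++ u' | u <- s, u' <- t] => w.
by case/ncmul_neq0=> u [u' [-> /fs su /gt tu']]; apply: allpairs_f.
Qed.

Lemma ncpoly_opp f : ncpoly f -> ncpoly (ncopp f).
Proof. by move=> [s fs]; exists s => w; rewrite /ncopp oppr_eq0 => /fs. Qed.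

Lemma ncpoly_sub f g : ncpoly f -> ncpoly g -> ncpoly (ncsub f g).
Proof. by move=> pf pg; apply: ncpoly_add pf (ncpoly_opp pg). Qed.

Lemma ncpoly_mon c u : ncpoly (ncmon c u).
Proof. by exists [:: u] => w /ncmon_neq0 ->; rewrite mem_head. Qed.

Lemma ncpoly_const c : ncpoly (@ncconst R n c).
Proof. exact: ncpoly_mon c [::]. Qed.

Lemma ncpoly_scale c f : ncpoly f -> ncpoly (ncscale c f).
Proof.
move=> [s fs]; exists s => w; rewrite /ncscale.
by case: (eqVneq (f w) 0) => [->|/fs //]; rewrite mulr0 eqxx.
Qed.

Lemma ncsub0 f : ncsub f (@nc0 R n) = f.
Proof. by apply: ncext => w; rewrite /ncsub /ncadd /ncopp oppr0 addr0. Qed.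

Lemma ncsubff f : ncsub f f = @nc0 R n.
Proof. by apply: ncext => w; rewrite /ncsub /ncadd /ncopp subrr. Qed.

Lemma ncsub_eq0 f g : ncsub f g = @nc0 R n -> f = g.
Proof.
move=> fg; apply: ncext => w; apply/eqP; rewrite -subr_eq0; apply/eqP.
exact: (congr1 (fun h => h w) fg).
Qed.

Lemma ncadd_subl f g h : ncadd (ncsub f g) (ncsub g h) = ncsub f h.
Proof. by apply: ncext => w; rewrite /ncsub /ncadd /ncopp addrA subrK. Qed.

Lemma ncopp_sub f g : ncopp (ncsub f g) = ncsub g f.
Proof. by apply: ncext => w; rewrite /ncsub /ncadd /ncopp opprB. Qed.

Lemma ncsubD f f' g g' :
  ncsub (ncadd f f') (ncadd g g') = ncadd (ncsub f g) (ncsub f' g').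
Proof. by apply: ncext => w; rewrite /ncsub /ncadd /ncopp opprD addrACA. Qed.

Lemma ncsubM f f' g g' : ncsub (ncmul f f') (ncmul g g') =
  ncadd (ncmul (ncsub f g) f') (ncmul g (ncsub f' g')).
Proof. by rewrite ncmulBl ncmulBr ncadd_subl. Qed.

Lemma ncscaleB c f g : ncscale c (ncsub f g) = ncsub (ncscale c f) (ncscale c g).
Proof. by apply: ncext => w; rewrite /ncsub /ncadd /ncopp /ncscale mulrBr. Qed.

(** * Two-sided ideals generated by a set, with multipliers in a prescribed class *)

Section Ideal.
Variables (P S : nc R n -> Prop).

Lemma gen_idealE f : gen_ideal P S f <->
  exists2 l : seq (nc R n * nc R n * nc R n),
    List.Forall (fun t => [/\ P t.1.1, S t.1.2 & P t.2]) l &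
    f = ncsum l (fun t => ncmul (ncmul t.1.1 t.1.2) t.2).
Proof.
split; last by case=> l Hl ->; exists l.
by case=> l [Hl fl]; exists l => //; apply: ncext.
Qed.

Lemma gen_ideal0 : gen_ideal P S (@nc0 R n).
Proof. by apply/gen_idealE; exists [::]; rewrite ?ncsum_nil. Qed.

Lemma gen_ideal_add_gen a g b f : P a -> S g -> P b -> gen_ideal P S f ->
  gen_ideal P S (ncadd (ncmul (ncmul a g) b) f).
Proof.
move=> Pa Sg Pb /gen_idealE [l Hl ->]; apply/gen_idealE; exists ((a, g, b) :: l).
  by constructor.
by rewrite ncsum_cons.
Qed.

Lemma gen_ideal_gen a g b : P a -> S g -> P b ->
  gen_ideal P S (ncmul (ncmul a g) b).
Proof.
move=> Pa Sg Pb; have := gen_ideal_add_gen Pa Sg Pb gen_ideal0.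
by congr gen_ideal; apply: ncext => w; rewrite /ncadd addr0.
Qed.

(** The tail [f] is kept in the ideal as well as in [J]: reduction modulo [m_v] is additive only on
    polynomials over [O_v], and membership of the tail is what supplies this. *)
Lemma gen_ideal_ind (J : nc R n -> Prop) :
  J (@nc0 R n) ->
  (forall a g b f, P a -> S g -> P b -> gen_ideal P S f -> J f ->
     J (ncadd (ncmul (ncmul a g) b) f)) ->
  forall f, gen_ideal P S f -> J f.
Proof.
move=> J0 JD f /gen_idealE [l Hl ->]; elim: Hl => [|[[a g] b] l' /= [Pa Sg Pb] Hl' IH].
  by rewrite ncsum_nil.
by rewrite ncsum_cons; apply: JD => //; apply/gen_idealE; exists l'.
Qed.

Lemma gen_ideal_add f g : gen_ideal P S f -> gen_ideal P S g -> gen_ideal P S (ncadd f g).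
Proof.
move=> If Ig; move: f If; apply: gen_ideal_ind => [|a h b f Pa Sh Pb _ IH].
  by congr gen_ideal: Ig; apply: ncext => w; rewrite /ncadd add0r.
have := gen_ideal_add_gen Pa Sh Pb IH.
by congr gen_ideal; apply: ncext => w; rewrite /ncadd addrA.
Qed.

Lemma gen_ideal_mull a f : (forall b, P b -> P (ncmul a b)) ->
  gen_ideal P S f -> gen_ideal P S (ncmul a f).
Proof.
move=> Pa; move: f; apply: gen_ideal_ind => [|b h c f Pb Sh Pc _ IH].
  by rewrite ncmul0r; apply: gen_ideal0.
by rewrite ncmulDr !ncmulA; apply: gen_ideal_add_gen => //; apply: Pa.
Qed.

Lemma gen_ideal_mulr a f : (forall b, P b -> P (ncmul b a)) ->
  gen_ideal P S f -> gen_ideal P S (ncmul f a).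
Proof.
move=> Pa; move: f; apply: gen_ideal_ind => [|b h c f Pb Sh Pc _ IH].
  by rewrite ncmul0l; apply: gen_ideal0.
by rewrite ncmulDl -ncmulA; apply: gen_ideal_add_gen => //; apply: Pa.
Qed.

Lemma gen_ideal_opp f : (forall b, P b -> P (ncopp b)) ->
  gen_ideal P S f -> gen_ideal P S (ncopp f).
Proof.
move=> PN If; have -> : ncopp f = ncmul (ncopp (@nc1 R n)) f by rewrite ncmulNl ncmul1l.
by apply: gen_ideal_mull If => b /PN; rewrite ncmulNl ncmul1l.
Qed.

End Ideal.

End NCRing.

(** [P] is an arbitrary proposition, whence the classical case distinctions. The lemma serves twice:
    for the coefficient of least value, and, with the order reversed, for the top degree of a graded
    element. *)
Lemma ex_seq_min (T : eqType) (r : rel T) (s : seq T) (P : T -> Prop) :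
  transitive r -> total r -> (exists2 x, x \in s & P x) ->
  exists x, [/\ x \in s, P x & forall y, y \in s -> P y -> r x y].
Proof.
move=> tr tot; have rr x : r x x by have /orP [] := tot x x.
elim: s => [|x s IH] [x0 //]; rewrite inE => s0 P0.
case: (classic (exists2 x, x \in s & P x)) => [/IH [m [sm Pm mm]]|noP]; last first.
  have x0x : x0 = x by case/orP: s0 => [/eqP //|s0]; case: noP; exists x0.
  exists x; split; [by rewrite mem_head | by rewrite -x0x |].
  by move=> y; rewrite inE => /orP [/eqP -> //|sy Py]; case: noP; exists y.
case: (classic (P x)) => [Px|nPx]; last first.
  exists m; split=> //; first by rewrite inE sm orbT.
  by move=> y; rewrite inE => /orP [/eqP -> /nPx|] //; apply: mm.
case/orP: (tot x m) => xm.
  exists x; split=> //; first by rewrite mem_head.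
  move=> y; rewrite inE => /orP [/eqP -> //|sy Py]; exact: tr xm (mm _ sy Py).
exists m; split=> //; first by rewrite inE sm orbT.
by move=> y; rewrite inE => /orP [/eqP -> //|]; apply: mm.
Qed.

(** * Valuations and normal forms *)

Section OrderedGroupTheory.
Variables (G : zmodType) (leG : rel G).
Hypothesis ordG : tot_ord_abgroup leG.
Implicit Types (x y z : G) (a b c : option G).

Lemma leG_refl x : leG x x. Proof. by case: ordG. Qed.
Lemma leG_trans : transitive leG. Proof. by case: ordG. Qed.
Lemma leG_total : total leG. Proof. by case: ordG. Qed.
Lemma leG_anti x y : leG x y -> leG y x -> x = y.
Proof. by case: ordG => _ H _ _ _ xy yx; apply: H; rewrite xy. Qed.
Lemma leG_add x y z t : leG x y -> leG z t -> leG (x + z) (y + t).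
Proof.
case: ordG => _ _ tr _ add xy zt; apply: tr (add _ _ z xy) _.
by rewrite ![y + _]addrC; apply: add.
Qed.
Lemma leG_opp x y : leG x y -> leG (- y) (- x).
Proof.
move=> xy; have := leG_add xy (leG_refl (- x - y)).
by rewrite addrA subrr add0r [- x - y]addrC addrA subrr add0r.
Qed.
Lemma leG_opp2 x y : leG (- y) (- x) = leG x y.
Proof. by apply/idP/idP => [/leG_opp|/leG_opp //]; rewrite !opprK. Qed.

Lemma ole_refl a : ole leG a a.
Proof. by case: a => //= x; apply: leG_refl. Qed.
Lemma ole_trans : transitive (ole leG).
Proof. by move=> [y|] [x|] [z|] //=; apply: leG_trans. Qed.
Lemma ole_total : total (ole leG).
Proof. by move=> [x|] [y|] //=; apply: leG_total. Qed.
Lemma ole_anti a b : ole leG a b -> ole leG b a -> a = b.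
Proof. by case: a b => [x|] [y|] //= xy yx; rewrite (leG_anti xy yx). Qed.
Lemma oltNge a b : olt leG a b = ~~ ole leG b a.
Proof.
rewrite /olt; have := ole_total a b; case: (eqVneq a b) => [->|ab]; first by rewrite ole_refl.
case E: (ole leG b a); rewrite ?orbF => ab'; last by rewrite ab'.
by rewrite andbT; apply/negP => ba; case/eqP: ab; apply: ole_anti.
Qed.
Lemma ole_oadd a b c d : ole leG a b -> ole leG c d -> ole leG (oadd a c) (oadd b d).
Proof. by case: a b c d => [x|] [y|] [z|] [t|] //=; apply: leG_add. Qed.
Lemma ole_omin a b c : ole leG c a -> ole leG c b -> ole leG c (omin leG a b).
Proof. by rewrite /omin; case: ifP. Qed.
Lemma omin_l a b : ole leG (omin leG a b) a.
Proof.
by rewrite /omin; case: ifP => [_|ab]; [apply: ole_refl | have := ole_total a b; rewrite ab].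
Qed.
Lemma omin_r a b : ole leG (omin leG a b) b.
Proof. by rewrite /omin; case: ifP => // _; apply: ole_refl. Qed.

Section ValuedField.
Variables (K : fieldType) (v : K -> option G).
Hypothesis val : valuation leG v.
Implicit Types (r s : K).

Lemma val_eq0 r : v r = None <-> r = 0. Proof. by case: val. Qed.
Lemma valM r s : v (r * s) = oadd (v r) (v s). Proof. by case: val. Qed.
Lemma valD r s : ole leG (omin leG (v r) (v s)) (v (r + s)). Proof. by case: val. Qed.
Lemma val_surj o : exists r, v r = o. Proof. by case: val. Qed.
Lemma val0 : v 0 = None. Proof. exact/val_eq0. Qed.

Lemma val1 : v 1 = Some 0.
Proof.
have := valM 1 1; rewrite mulr1; case E: (v 1) => [x|] /=; last first.
  by move/val_eq0/eqP: E; rewrite oner_eq0.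
by case=> x2; congr Some; apply: (addrI x); rewrite addr0.
Qed.

Lemma valN1 : v (-1) = Some 0.
Proof.
have := valM (-1) (-1); rewrite mulrNN mulr1 val1; case E: (v (-1)) => [x|] //= [x0].
(* Here [x + x = 0], and a totally ordered group has no torsion: adding [x] to either comparison
   with 0 yields the opposite one. *)
congr Some; case/orP: (leG_total 0 x) => le0; have := leG_add (leG_refl x) le0;
  by rewrite -x0 addr0 => le0'; apply: leG_anti.
Qed.

Lemma FvK0 g : FvK leG v g 0. Proof. by rewrite /FvK val0. Qed.
Lemma FvKD g r s : FvK leG v g r -> FvK leG v g s -> FvK leG v g (r + s).
Proof. by move=> gr gs; apply: ole_trans (valD r s); apply: ole_omin. Qed.
Lemma FvKM g h r s : FvK leG v g r -> FvK leG v h s -> FvK leG v (g + h) (r * s).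
Proof. by move=> gr gs; rewrite /FvK valM opprD; apply: (ole_oadd gr gs). Qed.
Lemma FvK_zero r : FvK leG v 0 r = Ov leG v r.
Proof. by rewrite /FvK oppr0. Qed.
Lemma FvKZ g r s : Ov leG v r -> FvK leG v g s -> FvK leG v g (r * s).
Proof. by rewrite -FvK_zero => vr vs; rewrite -[g]add0r; apply: FvKM. Qed.
Lemma FvK_mono g h r : leG g h -> FvK leG v g r -> FvK leG v h r.
Proof. by move=> gh; apply: ole_trans; rewrite /= leG_opp2. Qed.

Lemma Ov0 : Ov leG v 0. Proof. by rewrite -FvK_zero FvK0. Qed.
Lemma Ov1 : Ov leG v 1. Proof. by rewrite /Ov val1 ole_refl. Qed.
Lemma OvN1 : Ov leG v (-1). Proof. by rewrite /Ov valN1 ole_refl. Qed.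
Lemma OvD r s : Ov leG v r -> Ov leG v s -> Ov leG v (r + s).
Proof. by rewrite -!FvK_zero; apply: FvKD. Qed.
Lemma OvM r s : Ov leG v r -> Ov leG v s -> Ov leG v (r * s).
Proof. by move=> Or; rewrite -(FvK_zero s) -(FvK_zero (r * s)); apply: FvKZ. Qed.

Lemma mv0 : mv leG v 0. Proof. by rewrite /mv val0. Qed.
Lemma mv_Ov r : mv leG v r -> Ov leG v r. Proof. by case/andP. Qed.
Lemma mvD r s : mv leG v r -> mv leG v s -> mv leG v (r + s).
Proof.
rewrite /mv !oltNge => mr ms; apply/negP => H; have := ole_trans (valD r s) H.
by rewrite /omin; case: ifP => _; apply/negP.
Qed.
Lemma mvZ r s : Ov leG v r -> mv leG v s -> mv leG v (r * s).
Proof.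
rewrite /mv !oltNge valM /Ov => Or ms; apply/negP => H; case/negP: ms.
apply: ole_trans H; case: (v s) => [y|]; last by case: (v r).
have := ole_oadd Or (ole_refl (Some y)); by rewrite /= add0r.
Qed.
Lemma mvNval r : Ov leG v r -> ~~ mv leG v r -> v r = Some 0.
Proof. by rewrite /mv oltNge negbK => O1 O2; apply: ole_anti. Qed.

End ValuedField.
End OrderedGroupTheory.

Section Main.
Variables (K : fieldType) (G : zmodType) (leG : rel G) (v : K -> option G) (n : nat).
Variables (prec : rel (word n)) (Gb : nc K n -> Prop).
Hypothesis ordG : tot_ord_abgroup leG.
Hypothesis val : valuation leG v.
Hypothesis ordW : monomial_ordering prec.
Hypothesis GbO : forall g, Gb g -> Ovpoly leG v g.
Hypothesis GbG : groebner prec (Iof Gb) Gb.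
Hypothesis GbL : forall g w, Gb g -> is_LM prec g w -> w != [::].
Implicit Types (f g h p q a b : nc K n) (w u l r : word n) (c : K).

Local Notation I := (Iof Gb).
Local Notation IO := (gen_ideal (@Ovpoly K G leG v n) Gb).
Local Notation normal := (normal_word prec Gb).

Definition submodule_pred (P : K -> Prop) :=
  [/\ P 0, (forall c d, P c -> P d -> P (c + d)) &
      forall c d, Ov leG v c -> P d -> P (c * d)].

Lemma submodule_FvK (gam : G) : submodule_pred (FvK leG v gam).
Proof.
split; [exact: (FvK0 val) | by move=> c d; apply: (FvKD ordG val) |].
by move=> c d; apply: (FvKZ ordG val).
Qed.

Lemma submodule_Ov : submodule_pred (Ov leG v).
Proof.
split; [exact: (Ov0 val) | by move=> c d; apply: (OvD ordG val) |].
by move=> c d; apply: (OvM ordG val).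
Qed.

Lemma submodule_mv : submodule_pred (mv leG v).
Proof.
split; [exact: (mv0 val) | by move=> c d; apply: (mvD ordG val) |].
by move=> c d; apply: (mvZ ordG val).
Qed.

Lemma submodule_opp P c : submodule_pred P -> P c -> P (- c).
Proof. by case=> _ _ PZ Pc; rewrite -mulN1r; apply: PZ => //; apply: (OvN1 ordG val). Qed.

Lemma submodule_sum P (T : Type) (s : seq T) (F : T -> K) :
  submodule_pred P -> (forall i, P (F i)) -> P (\sum_(i <- s) F i).
Proof. by case=> P0 PD _ PF; elim/big_rec: _ => // i c _; apply: PD. Qed.

Lemma submodule_ncmul P f g : submodule_pred P ->
  (forall w, Ov leG v (f w)) -> (forall w, P (g w)) -> forall w, P (ncmul f g w).
Proof. by move=> SP Of Pg w; apply: submodule_sum => // i; case: SP => _ _; apply. Qed.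

Lemma mvOvpoly_Ovpoly f : mvOvpoly leG v f -> Ovpoly leG v f.
Proof. by case=> pf mf; split=> // w; apply: mv_Ov. Qed.

Lemma Ovpoly1 : Ovpoly leG v (@nc1 K n).
Proof.
split=> [|w]; first exact: ncpoly_const.
by rewrite /nc1 /ncconst; case: ifP => _; [apply: (Ov1 ordG val) | apply: (Ov0 val)].
Qed.
Lemma Ovpoly_add f g : Ovpoly leG v f -> Ovpoly leG v g -> Ovpoly leG v (ncadd f g).
Proof.
by move=> [pf Of] [pg Og]; split=> [|w]; [apply: ncpoly_add | apply: (OvD ordG val)].
Qed.
Lemma Ovpoly_opp f : Ovpoly leG v f -> Ovpoly leG v (ncopp f).
Proof.
by move=> [pf Of]; split=> [|w]; [apply: ncpoly_opp | apply: (submodule_opp submodule_Ov)].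
Qed.
Lemma Ovpoly_sub f g : Ovpoly leG v f -> Ovpoly leG v g -> Ovpoly leG v (ncsub f g).
Proof. by move=> Of Og; apply: Ovpoly_add Of (Ovpoly_opp Og). Qed.
Lemma Ovpoly_mul f g : Ovpoly leG v f -> Ovpoly leG v g -> Ovpoly leG v (ncmul f g).
Proof.
by move=> [pf Of] [pg Og]; split; [apply: ncpoly_mul | apply: (submodule_ncmul submodule_Ov)].
Qed.
Lemma Ovpoly_mon c u : Ov leG v c -> Ovpoly leG v (ncmon c u).
Proof.
move=> Oc; split=> [|w]; first exact: ncpoly_mon.
by rewrite /ncmon; case: ifP => // _; apply: (Ov0 val).
Qed.

Lemma Iof0 : I (@nc0 K n). Proof. exact: gen_ideal0. Qed.
Lemma IofD f g : I f -> I g -> I (ncadd f g). Proof. exact: gen_ideal_add. Qed.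
Lemma IofN f : I f -> I (ncopp f).
Proof. by apply: gen_ideal_opp => b; apply: ncpoly_opp. Qed.
Lemma IofB f g : I f -> I g -> I (ncsub f g).
Proof. by move=> If Ig; apply: IofD If (IofN Ig). Qed.
Lemma IofMl a f : ncpoly a -> I f -> I (ncmul a f).
Proof. by move=> pa; apply: gen_ideal_mull => b; apply: ncpoly_mul. Qed.
Lemma IofMr a f : ncpoly a -> I f -> I (ncmul f a).
Proof. by move=> pa; apply: gen_ideal_mulr => b pb; apply: ncpoly_mul. Qed.
Lemma IofZ c f : I f -> I (ncscale c f).
Proof. by rewrite -ncmul_constl; apply: IofMl; apply: ncpoly_const. Qed.
Lemma Iof_sub_sym f g : I (ncsub f g) -> I (ncsub g f).
Proof. by move/IofN; rewrite ncopp_sub. Qed.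
Lemma Iof_sub_trans f g h : I (ncsub f g) -> I (ncsub g h) -> I (ncsub f h).
Proof. by move=> fg gh; rewrite -(ncadd_subl f g h); apply: IofD. Qed.
Lemma Iof_subl f g : I (ncsub f g) -> I g -> I f.
Proof. by move=> fg Ig; rewrite -[f]ncsub0; apply: Iof_sub_trans fg _; rewrite ncsub0. Qed.
Lemma Iof_ncpoly f : I f -> ncpoly f.
Proof.
apply: gen_ideal_ind => [|a g b h pa Sg pb _ ph]; first exact: ncpoly0.
apply: ncpoly_add ph; apply: ncpoly_mul => //; apply: ncpoly_mul => //.
by case: (GbO Sg).
Qed.

Lemma IO_Iof f : IO f -> I f.
Proof.
apply: gen_ideal_ind => [|a g b h [pa _] Sg [pb _] _ ph]; first exact: Iof0.
exact: gen_ideal_add_gen.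
Qed.
Lemma IO_Ovpoly f : IO f -> Ovpoly leG v f.
Proof.
apply: gen_ideal_ind => [|a g b h Oa Sg Ob _ Oh].
  by split; [apply: ncpoly0 | move=> w; apply: (Ov0 val)].
by apply: Ovpoly_add Oh; apply: Ovpoly_mul => //; apply: Ovpoly_mul => //; apply: GbO.
Qed.

(** * Existence and uniqueness of normal forms *)

Section NormalForm.
Variables (P : K -> Prop) (J : nc K n -> Prop).
Hypothesis SP : submodule_pred P.
Hypothesis J0 : J (@nc0 K n).
Hypothesis JD : forall f g, J f -> J g -> J (ncadd f g).
Hypothesis Jgen : forall c l g r, P c -> Gb g -> J (ncbimon c l g r).

(** The set [J] of admissible errors is a parameter. With the ideal over [K] this serves the
    filtration; with the ideal generated over [O_v] a reduction to 0 becomes membership in [<G>]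
    over [O_v]. *)
Definition has_nf f := exists p,
  [/\ ncpoly p, forall u, p u != 0 -> normal u, forall u, P (p u) & J (ncsub f p)].

(** Induction on a list covering the support. Only monomials on words of the support are assumed
    reducible, so that the well-founded induction below can apply it to words smaller than the
    current one. *)
Lemma has_nf_lin f : ncpoly f -> (forall u, P (f u)) ->
  (forall u c, f u != 0 -> P c -> has_nf (ncmon c u)) -> has_nf f.
Proof.
case: (SP) => P0 PD _ [s]; elim: s f => [|x s IH] f fs Pf nff.
  have -> : f = @nc0 K n by apply: ncext => w; apply/eqP; apply: contraT => /fs.
  exists (@nc0 K n); split=> //; [exact: ncpoly0 | by move=> u; rewrite eqxx |].
  by rewrite ncsubff.
case: (eqVneq (f x) 0) => [fx|fx].
  apply: IH => // w fw; have := fs w fw; rewrite inE => /orP [/eqP wx|//].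
  by rewrite wx fx eqxx in fw.
pose f1 : nc K n := fun w => if w == x then 0 else f w.
have [|w|u c|p1 [pp1 n1 P1 J1]] := IH f1.
- move=> w; rewrite /f1; case: ifP => [|wx]; first by rewrite eqxx.
  by move/fs; rewrite inE wx.
- by rewrite /f1; case: ifP.
- by rewrite /f1; case: ifP => [|_]; [rewrite eqxx | apply: nff].
have [p [pp np Pp Jp]] := nff x (f x) fx (Pf x).
exists (ncadd p p1); split.
- exact: ncpoly_add.
- move=> u; case: (eqVneq (p u) 0) => [pu|/np //]; rewrite /ncadd pu add0r; apply: n1.
- by move=> u; apply: PD.
have -> : f = ncadd (ncmon (f x) x) f1.
  apply: ncext => w; rewrite /ncadd /ncmon /f1.
  by case: eqP => [->|]; rewrite ?addr0 ?add0r.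
by rewrite ncsubD; apply: JD.
Qed.

(** If [u = l wg r] is not normal, subtracting [c l g r] cancels [u] because [g] is monic; what
    remains involves smaller words, and its coefficients stay in [P] because those of [g] lie in
    [O_v]. *)
Lemma has_nf_mon u c : P c -> has_nf (ncmon c u).
Proof.
case: (SP) => P0 PD PZ.
case: ordW => _ [_ [_ [wf [comp _]]]]; elim: u / (wf u) c => u _ IH c Pc.
case: (classic (normal u)) => [nu|].
  exists (ncmon c u); split.
  - exact: ncpoly_mon.
  - by move=> w /ncmon_neq0 ->.
  - by move=> w; rewrite /ncmon; case: ifP.
  - by rewrite ncsubff.
move=> not_normal; have [g [wg [Sg LMg /infixP [l [r ulr]]]]] :
    exists g wg, [/\ Gb g, is_LM prec g wg & infix wg u].
  apply: NNPP => H; apply: not_normal => g wg Sg LMg; apply/negP => wgu.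
  by apply: H; exists g, wg.
(* Monicity gives coefficient 1 at some leading word; two distinct leading words would each precede
   the other, so that word is [wg]. *)
have gwg : g wg = 1.
  case: GbG => _ [/(_ g Sg) [w' [LMg' <-]] _]; congr (g _).
  case: LMg LMg' => gw gmax [gw' gmax']; case: (gmax' _ gw) => // H1.
  case: (gmax _ gw') => // H2; case: ordW => irr [tr _].
  by have := tr _ _ _ H1 H2; rewrite irr.
have Pb w : P (ncbimon c l g r w).
  case: (eqVneq (ncbimon c l g r w) 0) => [-> //|/ncbimon_neq0 [m -> _]].
  by rewrite ncbimon_cat mulrC; apply: PZ => //; case: (GbO Sg).
have pb : ncpoly (ncbimon c l g r).
  by do 2?apply: ncpoly_mul; rewrite ?[ncpoly g]/=; try exact: ncpoly_mon; case: (GbO Sg).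
have bu : ncbimon c l g r u = c by rewrite ulr ncbimon_cat gwg mulr1.
have [||w d|p [pp np Pp Jp]] := @has_nf_lin (ncsub (ncmon c u) (ncbimon c l g r)).
- by apply: ncpoly_sub pb; apply: ncpoly_mon.
- move=> w; apply: PD; last exact: submodule_opp.
  by rewrite /ncmon; case: ifP.
- move=> nz Pd; apply: IH Pd.
  (* At [u] the coefficients cancel. Any other word comes from a non-leading word of [g], and
     compatibility of the ordering with multiplication puts it below [u]. *)
  have [wu|wu] := eqVneq w u.
    by move: nz; rewrite wu /ncsub /ncadd /ncopp bu /ncmon eqxx subrr eqxx.
  have : ncbimon c l g r w != 0.
    by move: nz; rewrite /ncsub /ncadd /ncopp /ncmon (negbTE wu) add0r oppr_eq0.
  case/ncbimon_neq0=> m wm /(proj2 LMg) [mw|mw].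
    by case/eqP: wu; rewrite wm ulr mw.
  by rewrite wm ulr; apply: comp.
exists p; split=> //; have -> : ncsub (ncmon c u) p =
  ncadd (ncbimon c l g r) (ncsub (ncsub (ncmon c u) (ncbimon c l g r)) p).
  by apply: ncext => w; rewrite /ncsub /ncadd /ncopp; ring.
by apply: JD => //; apply: Jgen.
Qed.

Lemma ex_nf f : ncpoly f -> (forall u, P (f u)) -> has_nf f.
Proof. by move=> pf Pf; apply: has_nf_lin => // u c _; apply: has_nf_mon. Qed.

End NormalForm.

Lemma ex_nf_Iof P f : submodule_pred P -> ncpoly f -> (forall u, P (f u)) -> has_nf P I f.
Proof.
move=> SP; apply: ex_nf => // [|g h|c l g r _ Sg]; [exact: Iof0 | exact: IofD |].
by apply: gen_ideal_gen => //; apply: ncpoly_mon.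
Qed.

Lemma ex_nf_IO f : Ovpoly leG v f -> has_nf (Ov leG v) IO f.
Proof.
case; apply: ex_nf => [||g h|c l g r Oc Sg].
- exact: submodule_Ov.
- exact: gen_ideal0.
- exact: gen_ideal_add.
by apply: gen_ideal_gen => //; apply: Ovpoly_mon => //; apply: (Ov1 ordG val).
Qed.

(** The Gröbner property enters here: the leading word of a nonzero element of [I] contains some
    [LM(g)], so it is not normal. *)
Lemma Iof_normal_eq0 p : I p -> (forall u, p u != 0 -> normal u) -> p = @nc0 K n.
Proof.
move=> Ip np; apply: ncext => w; apply/eqP; apply: contraT => pw.
case: GbG => _ [_ /(_ p Ip)] [|wf [g [wg [l [r [[pwf _] Sg LMg wfE]]]]]]; first by exists w.
by have := np _ pwf _ _ Sg LMg; rewrite wfE infix_infix.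
Qed.

Lemma nf_unique p q : I (ncsub p q) -> (forall u, p u != 0 -> normal u) ->
  (forall u, q u != 0 -> normal u) -> p = q.
Proof.
move=> Ipq np nq; apply: ncsub_eq0; apply: Iof_normal_eq0 => // u.
case: (eqVneq (p u) 0) => [pu|/np //]; rewrite /ncsub /ncadd /ncopp pu add0r oppr_eq0.
exact: nq.
Qed.

(** The normal form of [f] vanishes, so [f] equals the error of its own reduction, which was built
    with multipliers over [O_v]. *)
Lemma Iof_Ovpoly f : I f -> Ovpoly leG v f -> IO f.
Proof.
move=> If /ex_nf_IO [p [pp np _ Jp]]; suff p0 : p = @nc0 K n by rewrite p0 ncsub0 in Jp.
apply: Iof_normal_eq0 => //; apply: Iof_subl If; apply: Iof_sub_sym; exact: IO_Iof.
Qed.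

Lemma groebner_Ovpoly : groebner prec (fun f => I f /\ Ovpoly leG v f) Gb.
Proof.
case: GbG => GI [monG LMG]; split; last by split=> // f [/LMG].
by move=> g Sg; split; [apply: GI | apply: GbO].
Qed.

Lemma good_reduction_Gb : good_reduction leG v Gb.
Proof.
move=> f; split; first by case; apply: Iof_Ovpoly.
by move=> IOf; split; [apply: IO_Iof | apply: IO_Ovpoly].
Qed.

(** * Reduction modulo the maximal ideal *)

Section ResidueField.
Variables (k : fieldType) (pi : K -> k).
Hypothesis res : residue_map leG v pi.

Lemma piD c d : Ov leG v c -> Ov leG v d -> pi (c + d) = pi c + pi d.
Proof. by case: res => H _ Oc Od; case: (H _ _ Oc Od). Qed.
Lemma piM c d : Ov leG v c -> Ov leG v d -> pi (c * d) = pi c * pi d.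
Proof. by case: res => H _ Oc Od; case: (H _ _ Oc Od). Qed.
Lemma pi_eq0 c : Ov leG v c -> pi c = 0 <-> mv leG v c.
Proof. by case: res => _ [_ [_ H]]; apply: H. Qed.
Lemma pi0 : pi 0 = 0.
Proof. by apply/pi_eq0; [apply: (Ov0 val) | apply: (mv0 val)]. Qed.
Lemma piN c : Ov leG v c -> pi (- c) = - pi c.
Proof.
move=> Oc; apply: (addrI (pi c)); rewrite subrr -piD ?subrr ?pi0 //.
exact: (submodule_opp submodule_Ov).
Qed.
Lemma pi_sum (T : Type) (s : seq T) (F : T -> K) : (forall i, Ov leG v (F i)) ->
  pi (\sum_(i <- s) F i) = \sum_(i <- s) pi (F i).
Proof.
move=> OF; elim: s => [|i s IH]; first by rewrite !big_nil pi0.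
rewrite !big_cons piD ?IH //; exact: (submodule_sum _ submodule_Ov).
Qed.

Definition ncred f : nc k n := fun w => pi (f w).
Local Notation J := (Jbar Gb pi).

Lemma ncpoly_red f : ncpoly f -> ncpoly (ncred f).
Proof.
move=> [s fs]; exists s => w; rewrite /ncred; case: (eqVneq (f w) 0) => [->|/fs //].
by rewrite pi0 eqxx.
Qed.
Lemma ncredD f g : Ovpoly leG v f -> Ovpoly leG v g ->
  ncred (ncadd f g) = ncadd (ncred f) (ncred g).
Proof. by move=> [_ Of] [_ Og]; apply: ncext => w; apply: piD. Qed.
Lemma ncredB f g : Ovpoly leG v f -> Ovpoly leG v g ->
  ncred (ncsub f g) = ncsub (ncred f) (ncred g).
Proof.
move=> Of Og; rewrite ncredD //; last exact: Ovpoly_opp.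
by congr ncadd; apply: ncext => w; apply: piN; case: Og.
Qed.
Lemma ncredM f g : Ovpoly leG v f -> Ovpoly leG v g ->
  ncred (ncmul f g) = ncmul (ncred f) (ncred g).
Proof.
move=> [_ Of] [_ Og]; apply: ncext => w; rewrite /ncred /ncmul pi_sum.
  by apply: eq_bigr => i _; rewrite piM.
by move=> i; apply: (OvM ordG val).
Qed.

Lemma Jbar_red f : IO f -> J (ncred f).
Proof.
move: f; apply: (@gen_ideal_ind _ _ _ _ (fun f => J (ncred f))) => [|a g b h Oa Sg Ob IOh Jh].
  have -> : ncred (@nc0 K n) = @nc0 k n by apply: ncext => w; apply: pi0.
  exact: gen_ideal0.
have Og := GbO Sg; have Oag := Ovpoly_mul Oa Og.
rewrite ncredD ?ncredM //; [|exact: Ovpoly_mul|exact: IO_Ovpoly].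
apply: gen_ideal_add_gen => //; [|by exists g|].
  by case: Oa => pa _; apply: ncpoly_red.
by case: Ob => pb _; apply: ncpoly_red.
Qed.

Lemma ncred_surj (h : nc k n) : ncpoly h -> exists2 f, Ovpoly leG v f & ncred f = h.
Proof.
(* The lift of 0 is chosen to be 0; otherwise the lifted function could lose its finite support. *)
move=> [s hs]; have lift (c : k) : exists a : K, (Ov leG v a /\ pi a = c) /\ (c = 0 -> a = 0).
  case: (eqVneq c 0) => [->|c0].
    by exists 0; rewrite pi0; do !split; apply: (Ov0 val).
  case: res => _ [_ [/(_ c) [a Ha] _]]; exists a; split=> // c0'.
  by rewrite c0' eqxx in c0.
pose f : nc K n := fun w => proj1_sig (constructive_indefinite_description _ (lift (h w))).
have fP w : (Ov leG v (f w) /\ pi (f w) = h w) /\ (h w = 0 -> f w = 0).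
  by rewrite /f; case: constructive_indefinite_description.
exists f; last by apply: ncext => w; case: (fP w) => [[]].
split; last by move=> w; case: (fP w) => [[]].
exists s => w fw; apply: hs; apply: contraNneq fw => hw.
by case: (fP w) => _ ->.
Qed.

(** Multipliers lift coefficientwise and generators lift by definition of [Gbar], so [IO] maps onto
    the whole of [Jbar]. *)
Lemma Jbar_lift (h : nc k n) : J h -> exists2 f, IO f & ncred f = h.
Proof.
move: h; apply: gen_ideal_ind => [|a gb b h pa [g [Sg gbE]] pb _ [f IOf <-]].
  by exists (@nc0 K n); [apply: gen_ideal0 | apply: ncext => w; apply: pi0].
have [a' Oa <-] := ncred_surj pa; have [b' Ob <-] := ncred_surj pb.
have -> : gb = ncred g by apply: ncext.
have Og := GbO Sg; have Oag := Ovpoly_mul Oa Og.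
exists (ncadd (ncmul (ncmul a' g) b') f); first exact: gen_ideal_add_gen.
by rewrite ncredD ?ncredM //; [apply: Ovpoly_mul | apply: IO_Ovpoly].
Qed.

(** This computes the kernel of [O_v<X> -> k<X>/<Gbar>]. In one direction, subtracting from [h] a
    lift in [IO] of its reduction leaves coefficients in [m_v]. In the other, good reduction places
    [h - m] in [IO], while [m] reduces to 0. *)
Lemma Jbar_redP h : Ovpoly leG v h ->
  J (ncred h) <-> exists2 m, mvOvpoly leG v m & I (ncsub h m).
Proof.
move=> Oh; split=> [/Jbar_lift [f IOf fh]|[m mm Ihm]].
  have Of := IO_Ovpoly IOf; exists (ncsub h f); last first.
    have -> : ncsub h (ncsub h f) = f.
      by apply: ncext => w; rewrite /ncsub /ncadd /ncopp; ring.
    exact: IO_Iof.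
  have [phf Ohf] := Ovpoly_sub Oh Of; split=> // w; apply/pi_eq0 => //.
  by rewrite -/(ncred _ w) ncredB // fh ncsubff.
have Om := mvOvpoly_Ovpoly mm.
have := Jbar_red (Iof_Ovpoly Ihm (Ovpoly_sub Oh Om)); rewrite ncredB //.
suff -> : ncred m = @nc0 k n by rewrite ncsub0.
by apply: ncext => w; apply/pi_eq0; [case: Om | case: mm].
Qed.

(** Elements of [Lambda] are represented by polynomials over [K] that are only congruent modulo [I]
    to integral ones, so an integral representative has to be chosen before reducing. *)
Definition lam_rep f :=
  epsilon (inhabits f) (fun h => Ovpoly leG v h /\ I (ncsub f h)).

Lemma lam_repP f : Lam leG v Gb f -> Ovpoly leG v (lam_rep f) /\ I (ncsub f (lam_rep f)).
Proof. by case=> _ ex; apply: epsilon_spec ex. Qed.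

(** Two integral representatives differ by an element of [I] over [O_v], hence of [IO] by good
    reduction. The choice is thus invisible modulo [Jbar], and every clause of the isomorphism
    follows by exhibiting a convenient representative. *)
Lemma Jbar_lam_rep f h : Lam leG v Gb f -> Ovpoly leG v h -> I (ncsub f h) ->
  J (ncsub (ncred (lam_rep f)) (ncred h)).
Proof.
move=> /lam_repP [Or Ir] Oh Ih; rewrite -ncredB //; apply: Jbar_red.
apply: Iof_Ovpoly; last exact: Ovpoly_sub.
exact: Iof_sub_trans (Iof_sub_sym Ir) Ih.
Qed.

Lemma lam_iso_red : lam_iso leG v Gb pi.
Proof.
have LamI f h : ncpoly f -> Ovpoly leG v h -> I (ncsub f h) -> Lam leG v Gb f.
  by move=> pf Oh Ih; split=> //; exists h.
have Jsym (f g : nc k n) : J (ncsub f g) -> J (ncsub g f).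
  by rewrite -[ncsub g f]ncopp_sub; apply: gen_ideal_opp => b; apply: ncpoly_opp.
exists (fun f => ncred (lam_rep f)); split.
- by move=> f /lam_repP [[pr _] _]; apply: ncpoly_red.
- move=> f f' Lf Lf'; have [Or Ir] := lam_repP Lf; have [Or' Ir'] := lam_repP Lf'.
  rewrite -ncredB //.
  have Idiff : I (ncsub (ncsub f f') (ncsub (lam_rep f) (lam_rep f'))).
    have -> : ncsub (ncsub f f') (ncsub (lam_rep f) (lam_rep f')) =
              ncsub (ncsub f (lam_rep f)) (ncsub f' (lam_rep f')).
      by apply: ncext => w; rewrite /ncsub /ncadd /ncopp; ring.
    exact: IofB.
  split=> [[_ [m [mm Im]]]|/Jbar_redP [|m mm Im]]; last 2 first.
  + exact: Ovpoly_sub.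
  + split; first by apply: ncpoly_sub; [case: Lf | case: Lf'].
    by exists m; split=> //; apply: Iof_sub_trans Idiff Im.
  apply/Jbar_redP; first exact: Ovpoly_sub.
  by exists m => //; apply: Iof_sub_trans (Iof_sub_sym Idiff) Im.
- move=> h /ncred_surj [f Of <-].
  have Iff : I (ncsub f f) by rewrite ncsubff; apply: Iof0.
  have Lf : Lam leG v Gb f by apply: LamI Iff => //; case: Of.
  by exists f; split=> //; apply: Jsym; apply: Jbar_lam_rep.
- move=> f f' Lf Lf'; have [Or Ir] := lam_repP Lf; have [Or' Ir'] := lam_repP Lf'.
  have [[pf _] [pf' _]] := (Lf, Lf'); rewrite -ncredD // -ncredM //.
  have Iadd : I (ncsub (ncadd f f') (ncadd (lam_rep f) (lam_rep f'))).
    by rewrite ncsubD; apply: IofD.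
  have Imul : I (ncsub (ncmul f f') (ncmul (lam_rep f) (lam_rep f'))).
    rewrite ncsubM; apply: IofD; first exact: IofMr.
    by apply: IofMl => //; case: Or.
  split; (apply: Jbar_lam_rep; [apply: LamI; last eassumption | | by []]).
  + exact: ncpoly_add.
  + exact: Ovpoly_add.
  + exact: Ovpoly_add.
  + exact: ncpoly_mul.
  + exact: Ovpoly_mul.
  + exact: Ovpoly_mul.
- split=> [|c f Oc Lf].
    have -> : @nc1 k n = ncred (@nc1 K n).
      apply: ncext => w; rewrite /ncred /nc1 /ncconst; case: ifP => _; last by rewrite pi0.
      by case: res => _ [->].
    have I11 : I (ncsub (@nc1 K n) (@nc1 K n)) by rewrite ncsubff; apply: Iof0.
    apply: (Jbar_lam_rep _ _ I11); last exact: Ovpoly1.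
    by apply: LamI I11; [apply: ncpoly_const | apply: Ovpoly1].
  have [[pr Or] Ir] := lam_repP Lf; have [pf _] := Lf.
  have -> : ncscale (pi c) (ncred (lam_rep f)) = ncred (ncscale c (lam_rep f)).
    by apply: ncext => w; rewrite /ncred /ncscale piM.
  have Ocr : Ovpoly leG v (ncscale c (lam_rep f)).
    by split=> [|w]; [apply: ncpoly_scale | apply: (OvM ordG val)].
  have Icr : I (ncsub (ncscale c f) (ncscale c (lam_rep f))).
    by rewrite -ncscaleB; apply: IofZ.
  by apply: Jbar_lam_rep => //; apply: LamI Icr => //; apply: ncpoly_scale.
Qed.

End ResidueField.

(** * The filtration on the quotient algebra *)

Implicit Types (gam del : G).
Local Notation filt := (filtA leG v prec Gb).
Local Notation filt_lt := (filtA_lt leG v prec Gb).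

(** The witness [f] need not be normal, since normalising it preserves the bound on coefficients.
    This is what makes the filtration multiplicative: a product of normal forms is in general not
    normal. *)
Lemma filtAI gam a f : ncpoly a -> ncpoly f -> (forall w, FvK leG v gam (f w)) ->
  I (ncsub a f) -> filt gam a.
Proof.
move=> pa pf Ff Iaf; have [p [pp np Fp Ip]] := ex_nf_Iof (submodule_FvK gam) pf Ff.
split=> //; exists p; split=> //; first by move=> w /np.
exact: Iof_sub_trans Iaf Ip.
Qed.

Lemma filtAE gam a : filt gam a -> exists p,
  [/\ ncpoly p, forall w, p w != 0 -> normal w, forall w, FvK leG v gam (p w) & I (ncsub a p)].
Proof.
case=> _ [p [pp np Ip]]; exists p; split=> // w; first by case/np.
by case: (eqVneq (p w) 0) => [->|/np [] //]; apply: (FvK0 val).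
Qed.

Lemma filtA_ncpoly gam a : filt gam a -> ncpoly a. Proof. by case. Qed.

Lemma filtA_Iof gam a : I a -> filt gam a.
Proof.
move=> Ia; apply: (@filtAI _ _ (@nc0 K n)); last by rewrite ncsub0.
- exact: Iof_ncpoly.
- exact: ncpoly0.
- by move=> w; apply: (FvK0 val).
Qed.

Lemma filtA_add gam a b : filt gam a -> filt gam b -> filt gam (ncadd a b).
Proof.
move=> Fa Fb; have [p [pp _ Fp Ip]] := filtAE Fa; have [q [pq _ Fq Iq]] := filtAE Fb.
apply: (@filtAI _ _ (ncadd p q)).
- by apply: ncpoly_add; [case: Fa | case: Fb].
- exact: ncpoly_add.
- by move=> w; apply: (FvKD ordG val).
- by rewrite ncsubD; apply: IofD.
Qed.

Lemma filtA_opp gam a : filt gam a -> filt gam (ncopp a).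
Proof.
move=> Fa; have [p [pp _ Fp Ip]] := filtAE Fa.
apply: (@filtAI _ _ (ncopp p)).
- by apply: ncpoly_opp; case: Fa.
- exact: ncpoly_opp.
- by move=> w; apply: (submodule_opp (submodule_FvK gam)).
have -> : ncsub (ncopp a) (ncopp p) = ncopp (ncsub a p).
  by apply: ncext => w; rewrite /ncsub /ncadd /ncopp; ring.
exact: IofN.
Qed.

Lemma filtA_mul gam del a b : filt gam a -> filt del b -> filt (gam + del) (ncmul a b).
Proof.
move=> Fa Fb; have [p [pp _ Fp Ip]] := filtAE Fa; have [q [pq _ Fq Iq]] := filtAE Fb.
apply: (@filtAI _ _ (ncmul p q)).
- by apply: ncpoly_mul; [case: Fa | case: Fb].
- exact: ncpoly_mul.
- move=> w; apply: (submodule_sum _ (submodule_FvK (gam + del))) => i.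
  exact: (FvKM ordG val).
rewrite ncsubM; apply: IofD; first by apply: IofMr => //; case: Fb.
exact: IofMl.
Qed.

Lemma filtA_mono gam del a : leG gam del -> filt gam a -> filt del a.
Proof.
move=> gd Fa; have [p [pp _ Fp Ip]] := filtAE Fa; apply: filtAI pp _ Ip; first by case: Fa.
by move=> w; apply: (FvK_mono ordG gd).
Qed.

Lemma filtA_lt_add gam a b : filt_lt gam a -> filt_lt gam b -> filt_lt gam (ncadd a b).
Proof.
move=> [g1 [lt1 F1]] [g2 [lt2 F2]]; case/orP: (leG_total ordG g1 g2) => le12.
  by exists g2; split=> //; apply: filtA_add => //; apply: filtA_mono F1.
by exists g1; split=> //; apply: filtA_add => //; apply: filtA_mono F2.
Qed.

Lemma filtA_lt_opp gam a : filt_lt gam a -> filt_lt gam (ncopp a).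
Proof. by move=> [g [lt F]]; exists g; split=> //; apply: filtA_opp. Qed.

Lemma filtA_lt_mull gam del a b : filt_lt gam a -> filt del b -> filt_lt (gam + del) (ncmul a b).
Proof.
move=> [g [/andP [le lt] F]] Fb; exists (g + del); split; last exact: filtA_mul.
by rewrite (leG_add ordG) ?(leG_refl ordG) //=; apply: contraNneq lt => /addIr ->.
Qed.

Lemma filtA_lt_mulr gam del a b : filt gam a -> filt_lt del b -> filt_lt (gam + del) (ncmul a b).
Proof.
move=> Fa [g [/andP [le lt] F]]; exists (gam + g); split; last exact: filtA_mul.
by rewrite (leG_add ordG) ?(leG_refl ordG) //=; apply: contraNneq lt => /addrI ->.
Qed.

(* A strict level: it refines [filt gam a /\ ~ filt_lt gam a], which also holds for [a] in the
   ideal when the value group is trivial. *)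
Definition slevel gam a := ncpoly a /\ exists p,
  [/\ ncpoly p, forall w, p w != 0 -> normal w, forall w, FvK leG v gam (p w),
      exists w, v (p w) = Some (- gam) & I (ncsub a p)].

Lemma slevel_ncpoly gam a : slevel gam a -> ncpoly a. Proof. by case. Qed.

Lemma slevel_notI gam a : slevel gam a -> ~ I a.
Proof.
move=> [_ [p [pp np Fp [w pw] Ip]]] Ia.
have p0 : p = @nc0 K n.
  by apply: Iof_normal_eq0 => //; apply: Iof_subl Ia; apply: Iof_sub_sym.
by move: pw; rewrite p0 (val0 val).
Qed.

Lemma ex_slevel a : ncpoly a -> ~ I a -> exists gam, slevel gam a.
Proof.
(* The whole field is taken as coefficient submodule: no bound is known yet, it is read off from the
   normal form. *)
move=> pa nIa; have [|//|//|p [pp np _ Ip]] := @ex_nf_Iof (fun=> True) a; first by [].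
have [w0 pw0] : exists w, p w != 0.
  apply: NNPP => H; apply: nIa; suff p0 : p = @nc0 K n by rewrite p0 ncsub0 in Ip.
  by apply: ncext => w; apply/eqP; apply: contraT => pw; case: H; exists w.
have [s ps] := pp.
have [|||w [sw pw wmin]] := @ex_seq_min _
  (fun u w => ole leG (v (p u)) (v (p w))) s (fun w => p w != 0).
- by move=> u u' u''; apply: (ole_trans ordG).
- by move=> u u'; apply: (ole_total ordG).
- by exists w0 => //; apply: ps.
case E: (v (p w)) => [g|]; last by move/(val_eq0 val): E => E; rewrite E eqxx in pw.
exists (- g); split=> //; exists p; rewrite opprK; split=> //; last by exists w.
move=> u; rewrite /FvK opprK -E; case: (eqVneq (p u) 0) => [->|pu].
  by rewrite (val0 val); case: (v _).
by apply: wmin => //; apply: ps.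
Qed.

(** By uniqueness any normal witness of [filt del a] is [p] itself, so its coefficient of value
    [- gam] decides. *)
Lemma slevel_filtAP gam del a : slevel gam a -> filt del a <-> leG gam del.
Proof.
move=> [pa [p [pp np Fp [w pw] Ip]]]; split=> [/filtAE [q [pq nq Fq Iq]]|gd].
  have pqE : p = q by apply: nf_unique => //; apply: Iof_sub_trans (Iof_sub_sym Ip) Iq.
  by have := Fq w; rewrite /FvK -pqE pw /= (leG_opp2 ordG).
by apply: filtAI Ip => // u; apply: (FvK_mono ordG gd).
Qed.

Lemma slevel_not_filtA_lt gam a : slevel gam a -> ~ filt_lt gam a.
Proof.
move=> La [g [/andP [le ne] /(slevel_filtAP _ La) ge]]; case/eqP: ne.
exact: (leG_anti ordG).
Qed.

Lemma filtA_slevel gam a : ~ I a -> filt gam a -> ~ filt_lt gam a -> slevel gam a.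
Proof.
move=> nIa Fa nFa; have [g La] := ex_slevel (filtA_ncpoly Fa) nIa.
have le := proj1 (slevel_filtAP _ La) Fa; case: (eqVneq g gam) => [<- //|ne].
by case: nFa; exists g; rewrite le ne; split=> //; apply/(slevel_filtAP _ La)/(leG_refl ordG).
Qed.

Lemma ex_filtA_level a : ncpoly a -> ~ I a -> exists gam, filt gam a /\ ~ filt_lt gam a.
Proof.
move=> pa nIa; have [g La] := ex_slevel pa nIa; exists g; split.
  by apply/(slevel_filtAP _ La); apply: (leG_refl ordG).
exact: slevel_not_filtA_lt.
Qed.

Lemma slevelZ gam del c a : v c = Some del -> slevel gam a -> slevel (gam - del) (ncscale c a).
Proof.
move=> vc [pa [p [pp np Fp [w pw] Ip]]]; split; first exact: ncpoly_scale.
exists (ncscale c p); split.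
- exact: ncpoly_scale.
- move=> u cpu; apply: np; apply: contraNneq cpu; rewrite /ncscale => ->.
  by rewrite mulr0.
- by move=> u; rewrite addrC; apply: (FvKM ordG val) => //; rewrite /FvK opprK vc (ole_refl ordG).
- by exists w; rewrite /ncscale (valM val) vc pw /= opprB.
- by rewrite -ncscaleB; apply: IofZ.
Qed.

(** The condition [LM(g) <> 1] enters here. It makes constants their own normal forms, so that [nu]
    restricts to [v] on [K]. *)
Lemma normal_nil : normal [::].
Proof.
by move=> g wg Sg LMg; apply: contra (GbL Sg LMg) => /size_infix; rewrite leqn0 size_eq0.
Qed.

Lemma slevel_const c gam : v c = Some gam -> slevel (- gam) (@ncconst K n c).
Proof.
move=> vc; split; first exact: ncpoly_const.
exists (@ncconst K n c); rewrite ncsubff opprK; split.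
- exact: ncpoly_const.
- by move=> w /(@ncmon_neq0 _ _ c [::]) ->; apply: normal_nil.
- move=> w; rewrite /ncconst; case: ifP => _; last exact: (FvK0 val).
  by rewrite /FvK opprK vc (ole_refl ordG).
- by exists [::].
- exact: Iof0.
Qed.

Lemma slevel1 : slevel 0 (@nc1 K n).
Proof. by rewrite -[0]oppr0; apply: slevel_const; apply: (val1 val). Qed.

(** * Multiplicativity of levels when the reduced algebra is a domain *)

Section DomainReduction.
Variables (k : fieldType) (pi : K -> k).
Hypothesis res : residue_map leG v pi.
Hypothesis dom : quot_domain (@ncpoly k n) (Jbar Gb pi).

(** Otherwise [p] would be congruent modulo [I] to a polynomial over [m_v], whose normal form is
    again over [m_v]; by uniqueness that normal form is [p], which has a coefficient of value 0. *)
Lemma slevel0_not_Jbar p : ncpoly p -> (forall w, p w != 0 -> normal w) ->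
  (forall w, Ov leG v (p w)) -> (exists w, v (p w) = Some 0) -> ~ Jbar Gb pi (ncred pi p).
Proof.
move=> pp np Op [w pw] /(Jbar_redP res (conj pp Op)) [m [pm mm] Ipm].
have [q [pq nq mq Iq]] := ex_nf_Iof submodule_mv pm mm.
have pqE : p = q by apply: nf_unique => //; apply: Iof_sub_trans Ipm Iq.
by have := mq w; rewrite -pqE /mv pw (oltNge ordG) (ole_refl ordG).
Qed.

(* Both representatives reduce to nonzero elements of the domain k<X>/<Gbar>; if the normal
   form of the product had all its coefficients in m_v, the product would reduce to zero. *)
Lemma slevel0_mul a b : slevel 0 a -> slevel 0 b -> slevel 0 (ncmul a b).
Proof.
move=> [pa [p [pp np Fp pw Ip]]] [pb [q [pq nq Fq qw Iq]]].
rewrite oppr0 in pw qw.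
have Op : Ovpoly leG v p by split=> // w; rewrite -FvK_zero.
have Oq : Ovpoly leG v q by split=> // w; rewrite -FvK_zero.
have Opq := Ovpoly_mul Op Oq.
have [t [pt nt Ot It]] := ex_nf_IO Opq; split; first exact: ncpoly_mul.
have Iabt : I (ncsub (ncmul a b) t).
  apply: (@Iof_sub_trans _ (ncmul p q)); last exact: IO_Iof.
  by rewrite ncsubM; apply: IofD; [apply: IofMr | apply: IofMl].
exists t; split=> //; first by move=> w; rewrite FvK_zero.
rewrite oppr0; apply: NNPP => noval.
have mt : mvOvpoly leG v t.
  split=> // w; apply: contraT => nm; case: noval; exists w.
  exact: (mvNval ordG (Ot w) nm).
have : Jbar Gb pi (ncred pi (ncmul p q)).
  by apply/(Jbar_redP res Opq); exists t => //; apply: IO_Iof.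
rewrite (ncredM res) //; case: dom => _ domM /domM [|||].
- exact: ncpoly_red.
- exact: ncpoly_red.
- by apply: slevel0_not_Jbar => //; case: Op.
- by apply: slevel0_not_Jbar => //; case: Oq.
Qed.

Lemma slevel_mul gam del a b : slevel gam a -> slevel del b -> slevel (gam + del) (ncmul a b).
Proof.
(* Surjectivity of [v] provides the scalars that bring both factors to level 0; the inverse of
   [c * d] undoes the scaling. *)
move=> La Lb; have [c vc] := val_surj val (Some gam); have [d vd] := val_surj val (Some del).
have := slevelZ vc La; have := slevelZ vd Lb; rewrite !subrr => Lb' La'.
have cd0 : c * d != 0.
  by apply/eqP => /(val_eq0 val); rewrite (valM val) vc vd.
have vecd : v (c * d)^-1 = Some (- (gam + del)).
  have := valM val (c * d) (c * d)^-1; rewrite divff // (val1 val) (valM val) vc vd.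
  case: (v _) => [x|] //= [] /eqP; rewrite eq_sym addrC addr_eq0 => /eqP -> //.
have := slevelZ vecd (slevel0_mul La' Lb').
rewrite sub0r opprK; congr slevel; apply: ncext => w.
rewrite /ncscale /ncmul !mulr_sumr; apply: eq_bigr => i _.
rewrite invfM; have /andP [c0 d0] : (c != 0) && (d != 0) by rewrite -negb_or -mulf_eq0.
by field; rewrite c0 d0.
Qed.

Lemma quot_domain_Iof : quot_domain (@ncpoly K n) I.
Proof.
split; first exact: slevel_notI slevel1.
move=> a b pa pb Iab; apply: NNPP => /not_or_and [nIa nIb].
have [g La] := ex_slevel pa nIa; have [h Lb] := ex_slevel pb nIb.
exact: slevel_notI (slevel_mul La Lb) Iab.
Qed.

Lemma ex_gr_top x (sx : seq G) : gr_elt leG v prec Gb x sx -> ~ gr_zero leG v prec Gb x ->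
  exists gam, [/\ gam \in sx, ~ filt_lt gam (x gam) &
    forall del, del \in sx -> ~ filt_lt del (x del) -> leG del gam].
Proof.
move=> [_ [_ xlt]] nz.
apply: (@ex_seq_min G (fun gam del => leG del gam) sx (fun gam => ~ filt_lt gam (x gam))).
- by move=> g h j hg jh; apply: (leG_trans ordG) jh hg.
- by move=> g h; apply: (leG_total ordG).
have [g ng] := not_all_ex_not _ _ nz; exists g => //.
by apply: contraT => /xlt.
Qed.

(** Compare components in degree [g + h], where [g] and [h] are the top degrees of [x] and [y]. The
    product of the top components has level exactly [g + h]. In every other summand some factor
    vanishes in [G(A)], since [a <= g], [b <= h] and [a + b = g + h] force [a = g] and [b = h]. *)
Lemma graded_domain_filtA : graded_domain leG v prec Gb.
Proof.
split; first exact: slevel_not_filtA_lt slevel1.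
move=> x sx y sy gx gy nzx nzy prod0.
have [g [sg ng gtop]] := ex_gr_top gx nzx; have [h [sh nh htop]] := ex_gr_top gy nzy.
have [usx [Fx _]] := gx; have [usy [Fy _]] := gy.
(* The vanishing assumed for contradiction yields some [e0 < 0]. Hence the group is not trivial, and
   elements of [I] do lie in every [F_<del]. *)
have [e0 [/andP [le0 ne0] _]] := prod0 0.
have Ilt (del : G) a : I a -> filt_lt del a.
  move=> Ia; exists (e0 + del); split; last exact: filtA_Iof.
  apply/andP; split; first by rewrite -{2}[del]add0r (leG_add ordG) ?(leG_refl ordG).
  by apply: contraNneq ne0 => E; apply/eqP; apply: (addIr del); rewrite add0r.
have lt_top (z : G -> nc K n) (t : G) :
    (forall s', filt s' (z s')) -> ~ filt_lt t (z t) -> slevel t (z t).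
  by move=> Fz nz; apply: filtA_slevel => //; apply: contra_not nz; apply: Ilt.
have Lxy := slevel_mul (lt_top _ _ Fx ng) (lt_top _ _ Fy nh).
apply: (slevel_not_filtA_lt Lxy); have := prod0 (g + h); rewrite /gr_mul.
have small (a b : G) : a \in sx -> b \in sy -> a + b = g + h -> (a != g) || (b != h) ->
    filt_lt (g + h) (ncmul (x a) (y b)).
  move=> sa sb ab ne; rewrite -ab.
  case: (classic (filt_lt a (x a))) => [ltx|nltx]; first exact: filtA_lt_mull.
  case: (classic (filt_lt b (y b))) => [lty|nlty]; first exact: filtA_lt_mulr.
  have ag := gtop a sa nltx; have bh := htop b sb nlty.
  have ga : leG g a.
    have := leG_add ordG bh (leG_refl ordG (a - h)).
    by rewrite [h + _]addrC subrK addrA [b + a]addrC ab addrK.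
  have aE := leG_anti ordG ag ga; move: ab; rewrite aE => /addrI bE.
  by rewrite aE bE !eqxx in ne.
have sum_lt (T : eqType) (s : seq T) (F : T -> nc K n) :
    (forall i, i \in s -> filt_lt (g + h) (F i)) -> filt_lt (g + h) (ncsum s F).
  by apply: ncsum_closed; [apply: Ilt; apply: Iof0 | apply: filtA_lt_add].
have sgh : h \in [seq b <- sy | g + b == g + h] by rewrite mem_filter eqxx.
rewrite (ncsum_rem _ sg) (ncsum_rem _ sgh).
move=> tot; set A := ncsum (rem h _) _ in tot; set B := ncsum (rem g _) _ in tot.
have ltA : filt_lt (g + h) A.
  apply: (sum_lt G) => b; rewrite mem_rem_uniq ?filter_uniq // !inE mem_filter.
  by case/and3P=> bh /eqP gb sb; apply: small => //; rewrite bh orbT.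
have ltB : filt_lt (g + h) B.
  apply: (sum_lt G) => a; rewrite mem_rem_uniq // !inE => /andP [ag sa].
  apply: (sum_lt G) => b; rewrite mem_filter => /andP [/eqP ab sb].
  by apply: small => //; rewrite ag.
(* The top term is recovered from the whole component by subtracting the remainders [A] and [B],
   both of lower level. *)
have -> : ncmul (x g) (y h) =
    ncadd (ncadd (ncadd (ncmul (x g) (y h)) A) B) (ncadd (ncopp A) (ncopp B)).
  by apply: ncext => w; rewrite /ncadd /ncopp; ring.
by apply: filtA_lt_add => //; apply: filtA_lt_add; apply: filtA_lt_opp.
Qed.

(** * The valuation attached to the filtration *)

Section FiltrationValuation.
Variable nu : nc K n -> option G.
Hypothesis nuP : is_filt_val leG v prec Gb nu.

Lemma nu_slevel gam a : slevel gam a -> nu a = Some (- gam).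
Proof.
case: nuP => _ H La; apply: H.
- exact: slevel_ncpoly La.
- exact: slevel_notI La.
- by apply/(slevel_filtAP _ La); apply: (leG_refl ordG).
- exact: slevel_not_filtA_lt.
Qed.

Lemma nu_Iof a : I a -> nu a = None.
Proof. by case: nuP => H _ Ia; apply: H => //; apply: Iof_ncpoly. Qed.

Lemma nu_spec a : ncpoly a ->
  I a /\ nu a = None \/ exists2 gam, slevel gam a & nu a = Some (- gam).
Proof.
move=> pa; case: (classic (I a)) => [Ia|nIa]; first by left; rewrite nu_Iof.
by right; have [g La] := ex_slevel pa nIa; exists g => //; apply: nu_slevel.
Qed.

(** This turns the ultrametric inequality for [nu] into closure of each filtration step under
    addition. *)
Lemma nu_filtA gam a : ncpoly a -> ole leG (Some (- gam)) (nu a) <-> filt gam a.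
Proof.
move=> /nu_spec [[Ia ->]|[g La ->]]; first by split=> // _; apply: filtA_Iof.
by rewrite (slevel_filtAP _ La) /= (leG_opp2 ordG).
Qed.

Lemma nu_const c : nu (@ncconst K n c) = v c.
Proof.
case E: (v c) => [g|]; first by rewrite (nu_slevel (slevel_const E)) opprK.
apply: nu_Iof; move/(val_eq0 val): E => ->.
have -> : @ncconst K n 0 = @nc0 K n by apply: ncext => w; rewrite /ncconst; case: ifP.
exact: Iof0.
Qed.

Lemma quot_valuation_nu : quot_valuation leG Gb nu.
Proof.
split; [|split; [|split; [|split]]].
- move=> a b pa pb Iab; have [[Ia ->]|[g La ->]] := nu_spec pa.
    by rewrite nu_Iof //; apply: Iof_subl Ia; apply: Iof_sub_sym.
  rewrite (@nu_slevel g) //; split=> //; case: La => _ [p [pp np Fp pw Ip]].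
  by exists p; split=> //; apply: Iof_sub_trans (Iof_sub_sym Iab) Ip.
- move=> o; have [c <-] := val_surj val o; exists (@ncconst K n c).
  by split; [apply: ncpoly_const | apply: nu_const].
- by move=> a /nu_spec [[Ia ->]|[g La ->]]; split=> // Ia; case: (slevel_notI La).
- move=> a b pa pb; have [[Ia ->]|[g La ->]] := nu_spec pa.
    by rewrite nu_Iof //; apply: IofMr.
  have [[Ib ->]|[h Lb ->]] := nu_spec pb; first by rewrite nu_Iof //; apply: IofMl.
  by rewrite (nu_slevel (slevel_mul La Lb)) opprD.
move=> a b pa pb; have [oa ob] := (omin_l ordG (nu a) (nu b), omin_r ordG (nu a) (nu b)).
have pab := ncpoly_add pa pb; case: (omin _ _ _) oa ob => [g|].
  rewrite -(opprK g) => /(nu_filtA _ pa) Fa /(nu_filtA _ pb) Fb.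
  by apply/(nu_filtA _ pab); apply: filtA_add.
have [[Ia ->]|[g La -> //]] := nu_spec pa; have [[Ib ->]|[h Lb -> //]] := nu_spec pb.
by move=> _ _; rewrite nu_Iof //; apply: IofD.
Qed.

End FiltrationValuation.

(** The assertion on fractions supplies no [nu], so one is constructed. It is well defined because
    the level is unique; functions of infinite support receive the default [None]. *)
Lemma ex_filt_val : exists nu, is_filt_val leG v prec Gb nu.
Proof.
have H a : exists o : option G, (I a -> o = None) /\
    (forall gam, ~ I a -> filt gam a -> ~ filt_lt gam a -> o = Some (- gam)).
  case: (classic (I a)) => [Ia|nIa]; first by exists None; split.
  case: (classic (ncpoly a)) => [pa|npa]; last first.
    by exists None; split=> // g _ /filtA_ncpoly.
  have [g La] := ex_slevel pa nIa; exists (Some (- g)); split=> // h _ Fa nFa.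
  have Lh := filtA_slevel nIa Fa nFa; congr (Some (- _)).
  by apply: (leG_anti ordG); [apply/(slevel_filtAP _ La) | apply/(slevel_filtAP _ Lh);
     apply/(slevel_filtAP _ La); apply: (leG_refl ordG)].
exists (fun a => proj1_sig (constructive_indefinite_description _ (H a))); split.
  by move=> a pa Ia; case: constructive_indefinite_description => o /= [-> //].
by move=> a g pa nIa Fa nFa; case: constructive_indefinite_description => o /= [_]; apply.
Qed.

End DomainReduction.

(** * The field of fractions *)

Section FractionField.
Variables (nu : nc K n -> option G) (D : unitRingType) (iota : nc K n -> D).
Hypothesis nuP : quot_valuation leG Gb nu.
Hypothesis frac : frac_field Gb iota.

Lemma iotaD a b : ncpoly a -> ncpoly b -> iota (ncadd a b) = iota a + iota b.
Proof. by case: frac => _ [H _] pa pb; case: (H a b pa pb). Qed.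
Lemma iotaM a b : ncpoly a -> ncpoly b -> iota (ncmul a b) = iota a * iota b.
Proof. by case: frac => _ [H _] pa pb; case: (H a b pa pb). Qed.
Lemma iota_Iof a b : ncpoly a -> ncpoly b -> iota a = iota b <-> I (ncsub a b).
Proof. by case: frac => _ [_ [_ [H _]]]; apply: H. Qed.
Lemma iota0 : iota (@nc0 K n) = 0.
Proof.
apply: (addrI (iota (@nc0 K n))); rewrite -iotaD ?addr0; try exact: ncpoly0.
by congr iota; apply: ncext => w; rewrite /ncadd addr0.
Qed.
Lemma iota_eq0 a : ncpoly a -> iota a = 0 <-> I a.
Proof. by move=> pa; rewrite -iota0 (iota_Iof pa (@ncpoly0 K n)) ncsub0. Qed.
Lemma iota_unit s : ncpoly s -> ~ I s -> iota s \is a GRing.unit.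
Proof. by case: frac => H _ ps nIs; apply: H; apply/eqP => /(iota_eq0 ps). Qed.

Lemma nu_iota a b : ncpoly a -> ncpoly b -> iota a = iota b -> nu a = nu b.
Proof. by case: nuP => H _ pa pb /(iota_Iof pa pb); apply: H. Qed.
Lemma nu_mul a b : ncpoly a -> ncpoly b -> nu (ncmul a b) = oadd (nu a) (nu b).
Proof. by case: nuP => _ [_ [_ [H _]]]; apply: H. Qed.
Lemma nu_eq_None a : ncpoly a -> nu a = None <-> I a.
Proof. by case: nuP => _ [_ [H _]]; apply: H. Qed.
Lemma nu_Some s : ncpoly s -> ~ I s -> exists gam, nu s = Some gam.
Proof. by move=> ps nIs; case E: (nu s) => [g|]; [exists g | case: nIs; apply/(nu_eq_None ps)]. Qed.

(* The right Ore condition, read off from writing s^-1 b as a right fraction. *)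
Lemma iota_ore s b : ncpoly s -> ncpoly b -> ~ I s ->
  exists c u : nc K n, [/\ ncpoly c, ncpoly u, ~ I u & iota b * iota u = iota s * iota c].
Proof.
move=> ps pb nIs; case: (frac) => _ [_ [_ [_ H]]].
have [c [u [pc pu nIu E]]] := H ((iota s)^-1 * iota b); exists c, u; split=> //.
have -> : iota c = (iota s)^-1 * iota b * iota u by rewrite E mulrVK // iota_unit.
by rewrite !mulrA divrr ?mul1r // iota_unit.
Qed.

(** The graph of [w(a/s) = nu(a) - nu(s)], stated as a relation since [d] has many presentations as
    a fraction. Requiring a finite [nu s] keeps the denominator outside [I]. *)
Definition frac_val (d : D) (o : option G) := exists (a s : nc K n) gam,
  [/\ ncpoly a, ncpoly s, nu s = Some gam, d = iota a / iota s & o = oadd (nu a) (Some (- gam))].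

Lemma nu_Some_notI s gam : ncpoly s -> nu s = Some gam -> ~ I s.
Proof. by move=> ps E /(nu_eq_None ps); rewrite E. Qed.

Lemma ex_frac_val d : exists o, frac_val d o.
Proof.
case: (frac) => _ [_ [_ [_ H]]]; have [a [s [pa ps nIs ->]]] := H d.
by have [g Es] := nu_Some ps nIs; exists (oadd (nu a) (Some (- g))), a, s, g.
Qed.

(* Two fractions a/s and b/t have the common denominator t u = s c. *)
Lemma frac_common s t : ncpoly s -> ncpoly t -> ~ I s -> ~ I t ->
  exists (c u : nc K n) (gc gu : G), [/\ [/\ ncpoly c, ncpoly u, nu c = Some gc & nu u = Some gu],
    oadd (nu t) (nu u) = oadd (nu s) (nu c),
    (forall a, iota a / iota s = iota a * iota c / (iota t * iota u)),
    (forall b, iota b / iota t = iota b * iota u / (iota t * iota u)) &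
    iota t * iota u = iota s * iota c].
Proof.
move=> ps pt nIs nIt; have [c [u [pc pu nIu E]]] := iota_ore ps pt nIs.
have nuE : oadd (nu t) (nu u) = oadd (nu s) (nu c).
  by rewrite -!nu_mul //; apply: nu_iota; rewrite ?iotaM //; apply: ncpoly_mul.
have [gt Et] := nu_Some pt nIt; have [gu Eu] := nu_Some pu nIu.
have [gc Ec] : exists gc, nu c = Some gc.
  by move: nuE; rewrite Et Eu; case: (nu s) (nu c) => [?|] [gc|] // _; exists gc.
have [us ut] := (iota_unit ps nIs, iota_unit pt nIt).
have [uu uc] := (iota_unit pu nIu, iota_unit pc (nu_Some_notI pc Ec)).
exists c, u, gc, gu; split=> // [a|b].
  by rewrite E invrM // mulrA mulrK.
by rewrite invrM // mulrA mulrK.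
Qed.

(** Over the common denominator [t u = s c] the numerators [a c] and [b u] have the same image in
    [D], hence the same value. *)
Lemma frac_val_fun d o o' : frac_val d o -> frac_val d o' -> o = o'.
Proof.
move=> [a [s [gs [pa ps Es -> ->]]]] [b [t [gt [pb pt Et E ->]]]].
have nIs := nu_Some_notI ps Es; have nIt := nu_Some_notI pt Et.
have [c [u [gc [gu [[pc pu Ec Eu] nuE fs ft tuE]]]]] := frac_common ps pt nIs nIt.
have utu : (iota t * iota u)^-1 \is a GRing.unit.
  by rewrite unitrV unitrMl; apply: iota_unit => //; apply: nu_Some_notI Eu.
have acbu : iota a * iota c = iota b * iota u.
  by apply: (mulIr utu); rewrite -fs -ft.
have : oadd (nu a) (nu c) = oadd (nu b) (nu u).
  by rewrite -!nu_mul //; apply: nu_iota; rewrite ?iotaM //; apply: ncpoly_mul.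
move: nuE; rewrite Ec Eu Es Et /= => -[tu].
case: (nu a) (nu b) => [x|] [y|] //= [xy]; congr Some.
have -> : x = y + gu - gc by rewrite -xy addrK.
have -> : gt = gs + gc - gu by rewrite -tu addrK.
by rewrite opprB [gs + gc]addrC opprD !addrA.
Qed.

(** With [b u = s c] one has [s^-1 b = c u^-1], so [(a/s)(b/t) = (a c)/(t u)]. *)
Lemma frac_valM d d' o o' : frac_val d o -> frac_val d' o' -> frac_val (d * d') (oadd o o').
Proof.
move=> [a [s [gs [pa ps Es -> ->]]]] [b [t [gt [pb pt Et -> ->]]]].
have nIs := nu_Some_notI ps Es; have nIt := nu_Some_notI pt Et.
have [c [u [pc pu nIu E]]] := iota_ore ps pb nIs; have [gu Eu] := nu_Some pu nIu.
have nuE : oadd (nu b) (nu u) = oadd (nu s) (nu c).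
  by rewrite -!nu_mul //; apply: nu_iota; rewrite ?iotaM //; apply: ncpoly_mul.
have [[us ut] uu] := (iota_unit ps nIs, iota_unit pt nIt, iota_unit pu nIu).
exists (ncmul a c), (ncmul t u), (gt + gu); split.
- exact: ncpoly_mul.
- exact: ncpoly_mul.
- by rewrite nu_mul // Et Eu.
- rewrite !iotaM // invrM // !mulrA; congr (_ / _).
  have -> : iota b = iota s * iota c / iota u by rewrite -E mulrK.
  by rewrite !mulrA divrK.
rewrite nu_mul //; move: nuE; rewrite Es Eu.
case: (nu a) (nu b) (nu c) => [x|] [y|] [z|] //= [yz]; congr Some.
have -> : y = gs + z - gu by rewrite -yz addrK.
by rewrite opprD; rewrite -!addrA; congr (_ + _); rewrite addKr; congr (_ + _); rewrite addrC.
Qed.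

(** By [frac_val_fun] all three values may be computed over one denominator, where the inequality is
    that of [nu] on numerators, shifted by a constant. *)
Lemma frac_valD d d' o o' o'' : frac_val d o -> frac_val d' o' -> frac_val (d + d') o'' ->
  ole leG (omin leG o o') o''.
Proof.
move=> Vd Vd' V; move: (Vd) (Vd').
move=> [a [s [gs [pa ps Es dE oE]]]] [b [t [gt [pb pt Et d'E o'E]]]].
have nIs := nu_Some_notI ps Es; have nIt := nu_Some_notI pt Et.
have [c [u [gc [gu [[pc pu Ec Eu] nuE fs ft tuE]]]]] := frac_common ps pt nIs nIt.
have [[pac pbu] ptu] := (ncpoly_mul pa pc, ncpoly_mul pb pu, ncpoly_mul pt pu).
have ntu : nu (ncmul t u) = Some (gt + gu) by rewrite nu_mul // Et Eu.
have Vof f e : ncpoly f -> e = iota f / iota (ncmul t u) ->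
    frac_val e (oadd (nu f) (Some (- (gt + gu)))).
  by move=> pf ->; exists f, (ncmul t u), (gt + gu).
have -> : o = oadd (nu (ncmul a c)) (Some (- (gt + gu))).
  by apply: frac_val_fun Vd (Vof _ _ pac _); rewrite !iotaM // -fs.
have -> : o' = oadd (nu (ncmul b u)) (Some (- (gt + gu))).
  by apply: frac_val_fun Vd' (Vof _ _ pbu _); rewrite !iotaM // -ft.
have -> : o'' = oadd (nu (ncadd (ncmul a c) (ncmul b u))) (Some (- (gt + gu))).
  apply: frac_val_fun V (Vof _ _ (ncpoly_add pac pbu) _).
  by rewrite iotaD // !iotaM // mulrDl -fs -ft dE d'E.
case: (nuP) => _ [_ [_ [_ /(_ _ _ pac pbu)]]].
move: (nu (ncmul a c)) (nu (ncmul b u)) (nu (ncadd _ _)) => x y z xyz.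
apply: (ole_trans ordG) (ole_oadd ordG xyz (ole_refl ordG _)).
have [->|->] : omin leG x y = x \/ omin leG x y = y.
- by rewrite /omin; case: ifP; [left | right].
- exact: (omin_l ordG).
- exact: (omin_r ordG).
Qed.

Lemma ex_valuation_frac : exists w : D -> option G,
  valuation leG w /\ forall a, ncpoly a -> w (iota a) = nu a.
Proof.
pose w d := proj1_sig (constructive_indefinite_description _ (ex_frac_val d)).
have wP d : frac_val d (w d) by rewrite /w; case: constructive_indefinite_description.
(* The value of 1 is finite because 1 is nonzero in [D], and [1 * 1 = 1] makes it idempotent in the
   group. Then [a/1] presents [iota a] with value [nu a]. *)
have nu1 : nu (@nc1 K n) = Some 0.
  case: (frac) => _ [_ [i1 _]].
  have p1 : ncpoly (@nc1 K n) by apply: ncpoly_const.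
  have nI1 : ~ I (@nc1 K n) by move/(iota_eq0 p1)/eqP; rewrite i1 oner_eq0.
  have [g E] := nu_Some p1 nI1; have := nu_mul p1 p1; rewrite ncmul1l E /= => -[gg].
  by congr Some; apply: (addrI g); rewrite addr0.
have wi a : ncpoly a -> w (iota a) = nu a.
  move=> pa; apply: frac_val_fun (wP _) _; exists a, (@nc1 K n), 0; split=> //.
  - exact: ncpoly_const.
  - by case: (frac) => _ [_ [-> _]]; rewrite divr1.
  - by case: (nu a) => //= x; rewrite subr0.
exists w; split=> //; split.
- by move=> o; case: (nuP) => _ [/(_ o) [a [pa <-]] _]; exists (iota a); apply: wi.
- move=> d; split=> [|->]; last first.
    by rewrite -iota0 wi ?nu_eq_None; [apply: Iof0 | apply: ncpoly0 | apply: ncpoly0].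
  have [a [s [g [pa ps Es dE ->]]]] := wP d; case E: (nu a) => [//|] _.
  by move/(nu_eq_None pa)/(iota_eq0 pa): E dE => ->; rewrite mul0r.
- by move=> d d'; apply: frac_val_fun (wP _) _; apply: frac_valM.
- by move=> d d'; apply: frac_valD.
Qed.

End FractionField.

End Main.

Theorem theorem6p3 (K : fieldType) (G : zmodType) (leG : rel G)
  (v : K -> option G) (n : nat) (prec : rel (word n)) (Gb : nc K n -> Prop) :
  tot_ord_abgroup leG ->
  valuation leG v ->
  monomial_ordering prec ->
  (forall g, Gb g -> Ovpoly leG v g) ->
  groebner prec (Iof Gb) Gb ->
  (forall g w, Gb g -> is_LM prec g w -> w != [::]) ->
  (* (v) *)
  (groebner prec (fun f => Iof Gb f /\ Ovpoly leG v f) Gb /\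
   good_reduction leG v Gb) /\
  forall (k : fieldType) (pi : K -> k), residue_map leG v pi ->
    (* (vi) *)
    ((exists g, Gb g /\ ~ mvOvpoly leG v g) -> lam_iso leG v Gb pi) /\
    (* (vii) *)
    ((exists g, Gb g /\ ~ mvOvpoly leG v g) ->
     quot_domain (@ncpoly k n) (Jbar Gb pi) ->
       graded_domain leG v prec Gb /\
       quot_domain (@ncpoly K n) (Iof Gb) /\
       (forall a, ncpoly a -> ~ Iof Gb a ->
          exists g, filtA leG v prec Gb g a /\ ~ filtA_lt leG v prec Gb g a) /\
       (forall nu : nc K n -> option G, is_filt_val leG v prec Gb nu ->
          quot_valuation leG Gb nu /\ forall c, nu (@ncconst K n c) = v c) /\
       (forall (D : unitRingType) (iota : nc K n -> D), frac_field Gb iota ->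
          exists w : D -> option G,
            valuation leG w /\ forall c, w (iota (@ncconst K n c)) = v c)).
Proof.
move=> ordG val ordW GbO GbG GbL; split.
  split; first exact: groebner_Ovpoly GbO GbG.
  exact: good_reduction_Gb ordG val ordW GbO GbG.
move=> k pi res; split=> [_|_ dom]; first exact: lam_iso_red ordG val ordW GbO GbG k pi res.
have quotV := quot_valuation_nu ordG val ordW GbO GbG GbL res dom.
have nuC := nu_const ordG val ordW GbO GbG GbL.
split; first exact: graded_domain_filtA ordG val ordW GbO GbG GbL k pi res dom.
split; first exact: quot_domain_Iof ordG val ordW GbO GbG GbL k pi res dom.
split; first exact: ex_filtA_level ordG val ordW GbO GbG.
split; first by move=> nu nuP; split; [apply: quotV | apply: nuC].
move=> D iota frac; have [nu nuP] := ex_filt_val ordG val ordW GbO GbG.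
have [w [valw wi]] := ex_valuation_frac ordG (quotV _ nuP) frac.
by exists w; split=> // c; rewrite wi ?nuC //; apply: ncpoly_const.
Qed.
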